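(* Let $n \ge 1$. If $T \in \mathcal{B}(H^2(\mathbb{D}^n))$ is a completely non-unitary contraction, then $T$ cannot be expressed as a product of two inner projections.
   Context: $H^2(\mathbb{D}^n)$ is the Hardy space of square summable analytic functions on the polydisc $\mathbb{D}^n$, and $H^\infty(\mathbb{D}^n)$ is the algebra of bounded analytic functions on $\mathbb{D}^n$. A function $\varphi \in H^\infty(\mathbb{D}^n)$ is inner if its radial limits satisfy $|\varphi| = 1$ a.e. on $\mathbb{T}^n$. An inner projection is an operator of the form $P_{\varphi H^2(\mathbb{D}^n)}$, the orthogonal projection of $H^2(\mathbb{D}^n)$ onto the closed subspace $\varphi H^2(\mathbb{D}^n)$, with $\varphi \in H^\infty(\mathbb{D}^n)$ inner. A contraction is completely non-unitary (cnu) if there is no nonzero closed reducing subspace on which it is unitary. *)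

(* Defs.v *)
From HB Require Import structures.
From mathcomp Require Import all_boot all_order all_algebra.
From mathcomp Require Import complex finmap.
From mathcomp Require Import all_classical all_reals all_analysis.
From mathcomp Require Import lra.
From mathcomp.analysis.showcase Require summability.

Set Implicit Arguments.
Unset Strict Implicit.
Unset Printing Implicit Defensive.

Import Order.TTheory GRing.Theory Num.Theory.
Import numFieldNormedType.Exports.

Local Open Scope classical_set_scope.
Local Open Scope complex_scope.
Local Open Scope ring_scope.

#[local] Existing Instance summability.totally_filter.

Section Polydisc.
Variables (R : realType) (n : nat).

Record polydisc := Polydisc {
  polydisc_val :> 'rV[R[i]]_n;
  _ : [forall i, `|polydisc_val 0 i| < 1] }.

HB.instance Definition _ := [isSub for polydisc_val].

Definition multiindex := {ffun 'I_n -> nat}.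

Definition monomial (z : 'rV[R[i]]_n) (k : multiindex) : R[i] :=
  \prod_(i < n) z 0 i ^+ k i.

(* [R[i]^o] is [R[i]] seen as a normed module over itself; convergence is
   unconditional: along the finite sets of multi-indices ordered by inclusion *)
Definition has_sum (u : multiindex -> R[i]) (l : R[i]) : Prop :=
  summability.partial_sum (u : multiindex -> R[i]^o) @ summability.totally
    --> (l : R[i]^o).

(* locally the sum of a convergent power series, around every point *)
Definition analytic (f : polydisc -> R[i]) : Prop :=
  forall w : polydisc, exists (r : R) (c : multiindex -> R[i]), 0 < r /\
    forall z : polydisc, (forall i, `|z 0 i - w 0 i| < r%:C) ->
      has_sum (fun k => c k * monomial (polydisc_val z - polydisc_val w) k)
              (f z).

Definition Hinfty (f : polydisc -> R[i]) : Prop :=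
  analytic f /\ exists M : R, forall z, `|f z| <= M%:C.

Definition square_summable (c : multiindex -> R[i]) : Prop :=
  (\esum_(k in [set: multiindex]) ((Normc.normc (c k)) ^+ 2)%:E < +oo)%E.

Definition hardy_expansion (f : polydisc -> R[i]) (c : multiindex -> R[i]) :
    Prop :=
  square_summable c /\ forall z : polydisc,
    has_sum (fun k => c k * monomial z k) (f z).

Definition hardy : {pred polydisc -> R[i]^o} :=
  mem [set f | exists c, hardy_expansion f c].

Lemma square_summableZD (s : R[i]) (a b : multiindex -> R[i]) :
  square_summable a -> square_summable b ->
  square_summable (fun k => s * a k + b k).
Proof.
have normc_ge0 (x : R[i]) : 0 <= Normc.normc x.
  by case: x => ? ?; exact: sqrtr_ge0.
have esumZ (x : R) (u : multiindex -> R) : 0 <= x -> (forall k, 0 <= u k) ->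
    (\esum_(k in [set: multiindex]) (u k)%:E < +oo)%E ->
    (\esum_(k in [set: multiindex]) (x * u k)%:E < +oo)%E.
  move=> x0 u0 uoo; have e0 : (0 <= \esum_(k in [set: multiindex]) (u k)%:E)%E.
    by apply: esum_ge0 => k _; rewrite lee_fin.
  apply: (@le_lt_trans _ _
    (x%:E * \esum_(k in [set: multiindex]) (u k)%:E)%E).
    apply: ge_ereal_sup => _ [A Afin <-].
    under eq_fsbigr do rewrite EFinM.
    rewrite -ge0_mule_fsumr; last by move=> k; rewrite lee_fin.
    by apply: lee_wpmul2l => //; apply: ereal_sup_ubound; exists A.
  by rewrite lte_mul_pinfty.
move=> a2 b2; rewrite /square_summable.
apply: (@le_lt_trans _ _ (\esum_(k in [set: multiindex])
  ((2 * Normc.normc s ^+ 2 * Normc.normc (a k) ^+ 2)%:E +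
   (2 * Normc.normc (b k) ^+ 2)%:E))%E).
  apply: le_esum => k _; rewrite -EFinD lee_fin.
  have := le_normcD (s * a k) (b k); rewrite Normc.normcM.
  set x := Normc.normc s; set y := Normc.normc (a k); set z := Normc.normc (b k).
  move=> h; apply: (@le_trans _ _ ((x * y + z) ^+ 2)).
    have xyz0 := le_trans (normc_ge0 (s * a k + b k)) h.
    by rewrite lerXn2r ?nnegrE ?normc_ge0.
  rewrite -mulrA -exprMn; have := sqr_ge0 (x * y - z); lra.
have normc2_ge0 (x : R[i]) : 0 <= Normc.normc x ^+ 2 by exact: sqr_ge0.
rewrite esumD; try by move=> k _; rewrite lee_fin !mulr_ge0.
by rewrite lte_add_pinfty//; apply: esumZ => //; rewrite mulr_ge0.
Qed.

Lemma hardy_submod_closed : submod_closed hardy.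
Proof.
split.
  rewrite inE; exists (fun=> 0); split.
    rewrite /square_summable esum1 ?ltry// => k _.
    by rewrite Normc.normc0 expr0n.
  move=> z; rewrite /has_sum.
  have -> : summability.partial_sum
     ((fun k => 0 * monomial z k) : multiindex -> R[i]^o) = cst 0.
    apply/funext => A; rewrite /summability.partial_sum big1// => k _.
    by rewrite mul0r.
  exact: cvg_cst.
move=> s f g /set_mem[a [a2 af]] /set_mem[b [b2 bg]]; apply/mem_set.
exists (fun k => s * a k + b k); split; last first.
  move=> z; rewrite /has_sum.
  have -> : summability.partial_sum
     ((fun k => (s * a k + b k) * monomial z k) : multiindex -> R[i]^o) =
     (fun A => s *: (summability.partial_sum
        ((fun k => a k * monomial z k) : multiindex -> R[i]^o) A) +
        summability.partial_sum
        ((fun k => b k * monomial z k) : multiindex -> R[i]^o) A).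
    apply/funext => A; rewrite /summability.partial_sum.
    rewrite scaler_sumr -big_split /=; apply: eq_bigr => k _.
    by rewrite mulrDl -mulrA.
  apply: cvgD; last exact: bg.
  apply: cvgZr; exact: af.
exact: square_summableZD.
Qed.

HB.instance Definition _ :=
  GRing.isSubmodClosed.Build _ _ hardy hardy_submod_closed.

Record H2 := MkH2 { H2_val :> polydisc -> R[i]^o; _ : H2_val \in hardy }.

HB.instance Definition _ := [isSub for H2_val].
HB.instance Definition _ := [Choice of H2 by <:].
HB.instance Definition _ := [SubChoice_isSubLmodule of H2 by <:].

(* the Taylor coefficients at the origin; the expansion of an element of [H2]
   exists by definition and is unique *)
Definition taylor (f : H2) : multiindex -> R[i] :=
  xget (fun=> 0) [set c | hardy_expansion f c].

Definition dot (f g : H2) : R[i] :=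
  summability.sum ((fun k => taylor f k * (taylor g k)^*)
                     : multiindex -> R[i]^o).

Definition hnorm (f : H2) : R := Num.sqrt (complex.Re (dot f f)).

Definition closed_subspace (M : set H2) : Prop :=
  [/\ M 0,
      forall (a : R[i]) (f g : H2), M f -> M g -> M (a *: f + g) &
      forall f, (forall e : R, 0 < e -> exists2 g, M g & hnorm (f - g) < e) ->
        M f].

Definition orthocompl (M : set H2) : set H2 :=
  [set f | forall g, M g -> dot f g = 0].

Definition bounded_op (T : H2 -> H2) : Prop :=
  exists K : R, forall f, hnorm (T f) <= K * hnorm f.

Definition contraction_op (T : H2 -> H2) : Prop :=
  forall f, hnorm (T f) <= hnorm f.

Definition reducing (T : H2 -> H2) (M : set H2) : Prop :=
  T @` M `<=` M /\ T @` orthocompl M `<=` orthocompl M.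

Definition unitary_on (T : H2 -> H2) (M : set H2) : Prop :=
  T @` M = M /\ forall f g, M f -> M g -> dot (T f) (T g) = dot f g.

Definition completely_non_unitary (T : H2 -> H2) : Prop :=
  ~ exists M : set H2,
      [/\ closed_subspace M, M <> [set 0], reducing T M & unitary_on T M].

(* determines [P], given [M]; it exists only if [M] is closed *)
Definition orthogonal_projection (P : H2 -> H2) (M : set H2) : Prop :=
  forall f, M (P f) /\ orthocompl M (f - P f).

Definition mult_range (phi : polydisc -> R[i]) : set H2 :=
  [set g | exists f : H2, forall z, g z = phi z * f z].

Definition extend (f : polydisc -> R[i]) (z : 'rV[R[i]]_n) : R[i] :=
  oapp f 0 (insub z).

Definition torus_point (t : n.-tuple R) : 'rV[R[i]]_n :=
  \row_i (cos (2 * pi * tnth t i) +i* sin (2 * pi * tnth t i)).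

End Polydisc.

Arguments H2 : clear implicits.

Section TorusMeasure.
Variable R : realType.

Section Product.
Context d1 d2 (T1 : measurableType d1) (T2 : measurableType d2).
Variables (P : probability T1 R) (Q : probability T2 R).

Let product_setT : (P \x Q)%E [set: T1 * T2] = 1%E.
Proof.
rewrite -setXTT product_measure1E// -[RHS]mule1.
by congr (_ * _)%E; exact: probability_setT.
Qed.

HB.instance Definition _ :=
  Measure_isProbability.Build _ _ _ (P \x Q)%E product_setT.

Definition product_probability : probability (T1 * T2)%type R := (P \x Q)%E.

End Product.

Definition tuple_cons n (x : measurableTypeR R * n.-tuple (measurableTypeR R)) :
    n.+1.-tuple (measurableTypeR R) :=
  [tuple of x.1 :: x.2].

Lemma measurable_tuple_cons n : measurable_fun setT (@tuple_cons n).
Proof. exact: measurable_cons. Qed.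

HB.instance Definition _ n := isMeasurableFun.Build _ _ _ _ (@tuple_cons n)
  (@measurable_tuple_cons n).

(* n-fold product of the uniform distribution on [0, 1]; its image under
   [torus_point] is the normalised Lebesgue measure of the torus *)
Fixpoint uniform_cube (n : nat) :
    probability (n.-tuple (measurableTypeR R)) R :=
  if n is m.+1 then
    distribution (product_probability (uniform_prob (@ltr01 R))
                                      (uniform_cube m))
                 (@tuple_cons m)
  else \d_ [tuple].

End TorusMeasure.

Definition inner_function (R : realType) (n : nat)
    (phi : polydisc R n -> R[i]) : Prop :=
  Hinfty phi /\
  {ae uniform_cube R n, forall t, exists l : R[i]^o, `|l| = 1 /\
     (extend phi (r%:C *: torus_point t) : R[i]^o) @[r --> (1 : R)^'-] --> l}.

Definition inner_projection (R : realType) (n : nat)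
    (P : {linear H2 R n -> H2 R n}) : Prop :=
  exists2 phi : polydisc R n -> R[i], inner_function phi &
    orthogonal_projection P (mult_range phi).

(* Main.v *)
Require Import Defs.
From mathcomp Require Import all_boot all_order all_algebra.
From mathcomp Require Import complex.
From mathcomp Require Import all_classical all_reals all_analysis.
From mathcomp Require Import finmap separable cyclic cyclotomic ring lra.
From mathcomp.analysis.showcase Require summability.

(** Let P and Q be the projections onto [phi H2] and [psi H2], and let
    [T = P Q].  On the intersection M of the two ranges both projections are
    the identity, hence so is T; and since P and Q are self-adjoint, a vector
    orthogonal to M is mapped by T to a vector orthogonal to M.  Thus M is a
    closed reducing subspace on which T is unitary
    ([product_projections_meet]), and T cannot be completely non-unitary unless
    M is zero.  But M contains [phi psi], which is not zero because at almost
    every point of the torus both factors have unimodular radial limits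
    ([inner_common_neq0]).

    The analytic substance is that [phi psi], as well as [phi] and [psi], lies
    in H2 at all: a bounded function that is locally the sum of power series
    has a global power series with square-summable coefficients.  The proof
    avoids integration and differentiation.  A function g of one variable is
    only asked to have, at each point w, a polynomial approximation p with
    [g (w + u) = p.[u] + O(|u|^L)] ([taylor_at]).  With [L = 3], the mean of g
    over the four points [w + t i^j] equals [g w + O(t^3)], while the mean of
    [|z|^2] over them is [|w|^2 + t^2]; so [|g z|^2 + e |z|^2] has no interior
    maximum and the maximum principle holds ([maximum_principle]).  Applied to
    Taylor remainders divided by a power of z, it gives Cauchy's estimates and
    the convergence of the Taylor expansion on the whole disc
    ([taylor_remainder]).

    A function f on the polydisc is studied through its slices [u |-> f (u z)],
    whose Taylor coefficients are the homogeneous parts of the expansion of f at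
    the origin.  Local expansions multiply, so the class [slice_analytic] is
    closed under products.  For a bounded f in it, the homogeneous parts
    sum to f uniformly on each smaller polydisc; evaluating on a grid of roots of
    unity, where monomials are orthogonal, bounds the sum of the squares of the
    coefficients ([coef_square_sum_le]), and the expansion converges
    unconditionally ([bounded_hardy_expansion]).  The zero function has bound 0,
    so the same estimate proves that expansions are unique, which makes the
    inner product of H2 sesquilinear. *)

Set Implicit Arguments.
Unset Strict Implicit.
Unset Printing Implicit Defensive.
Import Order.TTheory GRing.Theory Num.Theory.
Import numFieldNormedType.Exports.
Local Open Scope classical_set_scope.
Local Open Scope complex_scope.
Local Open Scope ring_scope.

#[local] Existing Instance summability.totally_filter.
Local Notation normc := Normc.normc.

(** * The real-valued complex modulus *)

Section Normc.
Variable R : realType.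
Implicit Types x y z : R[i].

Lemma normc_ge0 z : 0 <= normc z.
Proof. by case: z => ? ?; exact: sqrtr_ge0. Qed.

Lemma abs_normc z : `|z| = (normc z)%:C.
Proof. by case: z. Qed.

Lemma normc_sum (I : Type) (r : seq I) (P : pred I) (F : I -> R[i]) :
  normc (\sum_(i <- r | P i) F i) <= \sum_(i <- r | P i) normc (F i).
Proof.
elim/big_ind2: _ => [|x a y b xa yb|//]; first by rewrite Normc.normc0.
exact: le_trans (le_normcD _ _) (lerD xa yb).
Qed.

Lemma normcX z n : normc (z ^+ n) = normc z ^+ n.
Proof.
by elim: n => [|n IHn]; rewrite ?expr0 ?Normc.normc1// !exprS Normc.normcM IHn.
Qed.

Lemma normc_prod (I : Type) (r : seq I) (P : pred I) (F : I -> R[i]) :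
  normc (\prod_(i <- r | P i) F i) = \prod_(i <- r | P i) normc (F i).
Proof.
by elim/big_ind2: _ => [|x a y b <- <-|//]; rewrite ?Normc.normc1 ?Normc.normcM.
Qed.

Lemma normc_real (r : R) : normc r%:C = `|r|.
Proof. by rewrite /= expr0n/= addr0 sqrtr_sqr. Qed.

Lemma normcB x y : normc (x - y) = normc (y - x).
Proof. by rewrite -normcN opprB. Qed.

Lemma le_normcB x y : normc x - normc y <= normc (x - y).
Proof. by rewrite lerBlDr; apply: le_trans (le_normcD _ _); rewrite subrK. Qed.

Lemma sqr_normcE x : normc x ^+ 2 = complex.Re x ^+ 2 + complex.Im x ^+ 2.
Proof. by case: x => a b /=; rewrite sqr_sqrtr// addr_ge0 ?sqr_ge0. Qed.

Lemma normc_gt0 z : z != 0 -> 0 < normc z.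
Proof.
move=> z0; rewrite lt_neqAle normc_ge0 andbT eq_sym.
by apply: contra_neq z0; exact: Normc.eq0_normc.
Qed.

Lemma normc_i : normc ('i%C : R[i]) = 1.
Proof. by rewrite /= expr0n/= expr1n add0r sqrtr1. Qed.

Lemma normc_le_reim z : normc z <= `|complex.Re z| + `|complex.Im z|.
Proof.
rewrite -(@ler_pXn2r _ 2)// ?nnegrE ?addr_ge0 ?normc_ge0// sqr_normcE.
rewrite sqrrD !real_normK ?num_real// addrAC lerDl.
by rewrite mulrn_wge0// mulr_ge0.
Qed.

Lemma ge_normc_Re z : `|complex.Re z| <= normc z.
Proof.
rewrite -(@ler_pXn2r _ 2)// ?nnegrE ?normc_ge0// sqr_normcE.
by rewrite real_normK ?num_real// lerDl sqr_ge0.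
Qed.

Lemma ge_normc_Im z : `|complex.Im z| <= normc z.
Proof.
rewrite -(@ler_pXn2r _ 2)// ?nnegrE ?normc_ge0// sqr_normcE.
by rewrite real_normK ?num_real// lerDr sqr_ge0.
Qed.

Lemma sqr_normcC (w : R[i]) : (normc w ^+ 2)%:C = w * w^*.
Proof.
case: w => a b; rewrite sqr_normcE /=; apply/eqP; rewrite eq_complex /=.
by apply/andP; split; apply/eqP; ring.
Qed.

Lemma conjc_unit (w : R[i]) : normc w = 1 -> w^* = w^-1.
Proof.
move=> w1; have w0 : w != 0.
  apply/eqP => w0; move: w1; rewrite w0 Normc.normc0 => /eqP.
  by rewrite eq_sym oner_eq0.
by apply: (mulfI w0); rewrite mulfV// -sqr_normcC w1 expr1n.
Qed.

End Normc.

(** * Pointwise Taylor approximations *)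

Section TaylorAt.
Variable R : realType.
Local Notation C := R[i].
Implicit Types (f g : C -> C) (p q : {poly C}) (w : C).

(** The polynomial p need not have degree less than L; this keeps the notion
    stable under products without truncating. *)
Definition taylor_at g w p L : Prop := exists K d : R,
  [/\ 0 <= K, 0 < d & forall u, normc u < d ->
      normc (g (w + u) - p.[u]) <= K * normc u ^+ L].

Lemma poly_bounded p : exists2 K : R, 0 <= K &
  forall u, normc u < 1 -> normc p.[u] <= K.
Proof.
exists (\sum_(i < size p) normc p`_i).
  by apply: sumr_ge0 => i _; exact: normc_ge0.
move=> u u1; rewrite horner_coef; apply: le_trans (normc_sum _ _ _) _.
apply: ler_sum => i _; rewrite Normc.normcM normcX ler_piMr ?normc_ge0//.
by rewrite exprn_ile1 ?normc_ge0// ltW.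
Qed.

Lemma taylor_at_eq f g w p L : (exists2 d : R, 0 < d &
    forall u, normc u < d -> f (w + u) = g (w + u)) ->
  taylor_at g w p L -> taylor_at f w p L.
Proof.
move=> [d d0 fg] [K [e [K0 e0 gp]]]; exists K, (Num.min d e); split => //.
  by rewrite lt_min d0.
by move=> u; rewrite lt_min => /andP[/fg -> /gp].
Qed.

Lemma taylor_at_le g w p L L' : (L' <= L)%N ->
  taylor_at g w p L -> taylor_at g w p L'.
Proof.
move=> LL [K [d [K0 d0 gp]]]; exists K, (Num.min d 1); split => //.
  by rewrite lt_min d0/=.
move=> u; rewrite lt_min => /andP[ud u1]; apply: le_trans (gp _ ud) _.
by rewrite ler_wpM2l// ler_wiXn2l ?normc_ge0// ltW.
Qed.

Lemma taylor_atD f g w p q L : taylor_at f w p L -> taylor_at g w q L ->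
  taylor_at (fun z => f z + g z) w (p + q) L.
Proof.
move=> [K [d [K0 d0 fp]]] [K' [d' [K0' d0' gq]]].
exists (K + K'), (Num.min d d'); split; rewrite ?addr_ge0 ?lt_min ?d0//.
move=> u; rewrite lt_min => /andP[/fp ud /gq ud'].
rewrite hornerD opprD addrACA mulrDl.
exact: le_trans (le_normcD _ _) (lerD ud ud').
Qed.

Lemma taylor_atM f g w p q L : taylor_at f w p L -> taylor_at g w q L ->
  taylor_at (fun z => f z * g z) w (p * q) L.
Proof.
move=> [K [d [K0 d0 fp]]] [K' [d' [K0' d0' gq]]].
have [A A0 pA] := poly_bounded p; have [B B0 qB] := poly_bounded q.
exists (K * K' + K * B + A * K'), (Num.min (Num.min d d') 1); split.
- by rewrite !addr_ge0 ?mulr_ge0.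
- by rewrite !lt_min d0 d0'/=.
move=> u; rewrite !lt_min -andbA => /and3P[/fp ud /gq ud' u1].
rewrite hornerM (_ : _ - _ = (f (w + u) - p.[u]) * (g (w + u) - q.[u]) +
   (f (w + u) - p.[u]) * q.[u] + p.[u] * (g (w + u) - q.[u])); last by ring.
have uL : 0 <= normc u ^+ L by rewrite exprn_ge0 ?normc_ge0.
have uL1 : normc u ^+ L <= 1 by rewrite exprn_ile1 ?normc_ge0// ltW.
rewrite [leRHS]mulrDl [X in _ <= X + _]mulrDl.
apply: le_trans (le_normcD _ _) _; apply: lerD.
  apply: le_trans (le_normcD _ _) _; rewrite !Normc.normcM; apply: lerD.
    rewrite -mulrA; apply: le_trans (ler_pM _ _ ud ud') _; rewrite ?normc_ge0//.
    by rewrite -mulrA ler_wpM2l// ler_piMl// mulr_ge0.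
  apply: le_trans (ler_pM _ _ ud (qB _ u1)) _; rewrite ?normc_ge0//.
  by rewrite mulrAC.
rewrite Normc.normcM -mulrA.
by apply: ler_pM; rewrite ?normc_ge0// pA.
Qed.

Lemma taylor_at_poly p w L :
  taylor_at (fun z => p.[z]) w (p \Po ('X + w%:P)) L.
Proof.
exists 0, 1; split => // u _.
by rewrite horner_comp !hornerE [u + w]addrC subrr Normc.normc0.
Qed.

Lemma taylor_at_cst c w L : taylor_at (fun=> c) w c%:P L.
Proof.
by exists 0, 1; split => // u _; rewrite hornerC subrr Normc.normc0 mul0r.
Qed.

(** Only the coefficients of degree less than L matter: the others contribute
    a multiple of [u ^+ L] to the error. *)
Lemma taylor_at_trunc g w p q L : (forall i, (i < L)%N -> p`_i = q`_i) ->
  taylor_at g w p L -> taylor_at g w q L.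
Proof.
move=> pq [K [d [K0 d0 gp]]].
have [A A0 pA] := poly_bounded (drop_poly L p - drop_poly L q).
exists (K + A), (Num.min d 1); split; rewrite ?addr_ge0 ?lt_min ?d0//=.
move=> u; rewrite lt_min => /andP[/gp ud u1].
have -> : g (w + u) - q.[u] = (g (w + u) - p.[u]) + (p - q).[u].
  by rewrite hornerD hornerN; ring.
have -> : p - q = (drop_poly L p - drop_poly L q) * 'X^L.
  rewrite -{1}(poly_take_drop L p) -{1}(poly_take_drop L q).
  have -> : take_poly L p = take_poly L q.
    by apply/polyP => i; rewrite !coef_take_poly; case: ifP => // /pq.
  by ring.
rewrite [leRHS]mulrDl hornerM hornerXn.
apply: le_trans (le_normcD _ _) (lerD ud _).
rewrite Normc.normcM normcX ler_wpM2r ?exprn_ge0 ?normc_ge0//.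
exact: pA.
Qed.

Lemma taylor_at_rot g w p L (c : C) : normc c = 1 -> taylor_at g (c * w) p L ->
  taylor_at (fun z => g (c * z)) w (p \Po (c *: 'X)) L.
Proof.
move=> c1 [K [d [K0 d0 gp]]]; exists K, d; split => // u ud.
rewrite mulrDr horner_comp !hornerE.
by have := gp (c * u); rewrite Normc.normcM c1 mul1r; apply.
Qed.

Lemma taylor_at_sum (I : Type) (r : seq I) (f : I -> C -> C)
    (p : I -> {poly C}) w L : (forall i, taylor_at (f i) w (p i) L) ->
  taylor_at (fun z => \sum_(i <- r) f i z) w (\sum_(i <- r) p i) L.
Proof.
move=> fp; elim: r => [|i r IHr].
  rewrite big_nil; apply: taylor_at_eq (taylor_at_cst 0 w L).
  by exists 1 => // u _; rewrite big_nil.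
rewrite big_cons; apply: taylor_at_eq (taylor_atD (fp i) IHr).
by exists 1 => // u _; rewrite big_cons.
Qed.

(** The error is exactly [- u^3 / (w^3 (w + u))], and [|w + u| >= |w| / 2] near w. *)
Lemma taylor_at_inv w : w != 0 ->
  taylor_at (fun z => z^-1) w ((w^-1)%:P - w^-2 *: 'X + w^-3 *: 'X^2) 3.
Proof.
move=> w0; have nw0 := normc_gt0 w0.
exists (2 * normc w ^- 4), (normc w / 2); split.
- by rewrite mulr_ge0 ?invr_ge0 ?exprn_ge0 ?normc_ge0.
- by lra.
move=> u uw; have wu : normc w / 2 <= normc (w + u).
  have := le_normcB w (- u); rewrite normcN opprK; lra.
have wu0 : w + u != 0.
  by apply/eqP => wu0; move: wu; rewrite wu0 Normc.normc0; lra.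
rewrite !hornerD hornerN hornerC !hornerZ hornerX hornerXn.
rewrite (_ : _ - _ = - u ^+ 3 * (w ^- 3 * (w + u)^-1)); last first.
  by field; rewrite wu0.
rewrite Normc.normcM normcN normcX mulrC ler_wpM2r ?exprn_ge0 ?normc_ge0//.
rewrite Normc.normcM !Normc.normcV normcX.
rewrite (_ : 2 * _ = normc w ^- 3 * (normc w / 2)^-1); last by field; lra.
rewrite ler_wpM2l ?invr_ge0 ?exprn_ge0 ?normc_ge0// lef_pV2 ?posrE//; lra.
Qed.

(** All that the maximum principle needs to know about a function at a point,
    in place of complex differentiability. *)
Definition second_order g w := exists p, taylor_at g w p 3.

Lemma second_orderM f g w : second_order f w -> second_order g w ->
  second_order (fun z => f z * g z) w.
Proof. by move=> [p fp] [q gq]; exists (p * q); exact: taylor_atM. Qed.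

Lemma second_orderD f g w : second_order f w -> second_order g w ->
  second_order (fun z => f z + g z) w.
Proof. by move=> [p fp] [q gq]; exists (p + q); exact: taylor_atD. Qed.

Lemma second_orderVX w m : w != 0 -> second_order (fun z => z ^- m) w.
Proof.
move=> w0; elim: m => [|m [q IHm]].
  eexists; apply: taylor_at_eq (taylor_at_cst 1 w 3).
  by exists 1 => // u _; rewrite expr0 invr1.
eexists; apply: taylor_at_eq (taylor_atM (taylor_at_inv w0) IHm).
by exists 1 => // u _; rewrite exprS invfM.
Qed.

Lemma taylor_at_lipschitz g w p L : (0 < L)%N -> taylor_at g w p L ->
  exists K d : R, [/\ 0 <= K, 0 < d &
    forall u, normc u < d -> normc (g (w + u) - g w) <= K * normc u].
Proof.
move=> L0 /(taylor_at_le L0) /(taylor_at_trunc (q := (p`_0)%:P)) [].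
  by move=> [|//] _; rewrite coefC.
move=> K [d [K0 d0 gp]]; exists K, d; split => // u ud.
have := gp 0; rewrite Normc.normc0 addr0 hornerC expr1 mulr0.
move=> /(_ d0) g0; have /Normc.eq0_normc/subr0_eq -> : normc (g w - p`_0) = 0.
  by apply/le_anti; rewrite g0 normc_ge0.
by have := gp _ ud; rewrite hornerC expr1.
Qed.

Lemma taylor_at_val g w p L : taylor_at g w p L.+1 -> g w = p.[0].
Proof.
move=> [K [d [K0 d0 gp]]]; apply/subr0_eq/Normc.eq0_normc/le_anti.
by have := gp 0; rewrite Normc.normc0 addr0 expr0n mulr0 normc_ge0 andbT; apply.
Qed.

Lemma coef_comp_polyZX (p : {poly C}) c i : (p \Po (c *: 'X))`_i = p`_i * c ^+ i.
Proof.
rewrite coef_comp_poly; have [ip|pi] := ltnP i (size p); last first.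
  rewrite (nth_default _ pi) mul0r big1// => k _.
  by rewrite exprZn coefZ coefXn gtn_eqF ?mulr0//; exact: leq_trans pi.
rewrite (bigD1 (Ordinal ip))//= exprZn coefZ coefXn eqxx mulr1 big1 ?addr0//.
move=> k ki; rewrite exprZn coefZ coefXn (_ : (i == k) = false) ?mulr0//.
by apply: contra_neqF ki => /eqP ik; exact/val_inj.
Qed.

End TaylorAt.

(** * The maximum principle *)

Section MaximumPrinciple.
Variable R : realType.
Local Notation C := R[i].
Implicit Types (g : C -> C) (w z : C).

(** Extreme value theorem on a closed disc, with continuity in epsilon-delta
    form; the disc is compact as a subset of the real plane. *)
Lemma disc_max (s : R) (U : C -> R) : 0 <= s ->
  (forall w, normc w <= s -> forall e : R, 0 < e -> exists2 d : R, 0 < d &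
     forall u, normc u < d -> `|U (w + u) - U w| < e) ->
  exists2 w, normc w <= s & forall z, normc z <= s -> U z <= U w.
Proof.
move=> s0 Uc.
pose N (x : R * R) := x.1 ^+ 2 + x.2 ^+ 2.
have NE (a b : R) : (normc (a +i* b) <= s) = (N (a, b) <= s ^+ 2).
  by rewrite -(@ler_pXn2r _ 2)// ?nnegrE ?normc_ge0// sqr_normcE.
pose D := [set x : R * R | N x <= s ^+ 2].
have Dcompact : compact D.
  have Nc : continuous N.
    move=> x; apply: cvgD; apply: (@continuous_comp _ _ _ _ (fun r : R => r ^+ 2));
      by [exact: cvg_fst|exact: cvg_snd|exact: exprn_continuous].
  apply: (@subclosed_compact _ _ (`[- s, s] `*` `[- s, s])).
  - apply: (@preimage_closed _ _ N [set r | r <= s ^+ 2]) => [x _|].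
      exact: Nc.
    exact: closed_le.
  - by apply: compact_setX; exact: segment_compact.
  move=> [a b]; rewrite /D /N /= => abs; rewrite !in_itv/= -!ler_norml.
  by split; rewrite -(@ler_pXn2r _ 2)// ?nnegrE// real_normK ?num_real//;
    apply: le_trans abs; rewrite ?lerDl ?lerDr sqr_ge0.
have [||[a b] /set_mem abD abmax] :=
    @compact_EVT_max _ R (fun x : R * R => U (x.1 +i* x.2)) D _ Dcompact.
- by exists (0, 0); rewrite /D /N /= !expr0n/= addr0 sqr_ge0.
- apply: continuous_in_subspaceT => -[a b] /set_mem abD.
  apply/cvgrPdist_lt => e e0; have [|d d0 dU] := Uc (a +i* b) _ _ e0.
    by rewrite NE.
  have d20 : 0 < d / 2 by lra.
  near=> y; rewrite distrC.
  have -> : y.1 +i* y.2 = (a +i* b) + ((y.1 - a) +i* (y.2 - b)).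
    by apply/eqP; rewrite eq_complex /= !subrKC !eqxx.
  apply: dU.
  apply: le_lt_trans (normc_le_reim _) _ => /=.
  suff : `|y.1 - a| < d / 2 /\ `|y.2 - b| < d / 2 by lra.
  by split; rewrite distrC; near: y;
    apply: (cvgr_dist_lt (F := nbhs (a, b))) => //;
    [exact: cvg_fst|exact: cvg_snd].
exists (a +i* b); first by rewrite NE.
by move=> [c d]; rewrite NE => cd; apply: (abmax (c, d)); exact/mem_set.
Unshelve. all: by end_near. Qed.

(** Sub-mean value property: the four points [w + t i^j] cancel the terms of
    degree 1 and 2 of the local expansion, so the values of g there add up to
    [4 g w + O(t^3)].  The squares are bounded below through
    [(x - |g w|)^2 >= 0]. *)
Lemma four_point_mean g w : second_order g w -> exists K d : R,
  [/\ 0 <= K, 0 < d & forall t : R, 0 < t < d ->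
    4 * normc (g w) ^+ 2 - K * t ^+ 3 <=
      normc (g (w + t%:C)) ^+ 2 + normc (g (w - t%:C)) ^+ 2 +
      normc (g (w + t%:C * 'i)) ^+ 2 + normc (g (w - t%:C * 'i)) ^+ 2].
Proof.
move=> [p /(taylor_at_trunc (q := (p`_0)%:P + p`_1 *: 'X + p`_2 *: 'X^2))].
case=> [|K [d [K0 d0 gp]]].
  by move=> [|[|[|//]]] _; rewrite !coefD !coefZ coefC coefX coefXn /=;
     rewrite ?mulr0 ?mulr1 ?addr0 ?add0r.
have hE u : ((p`_0)%:P + p`_1 *: 'X + p`_2 *: 'X^2).[u] =
    p`_0 + p`_1 * u + p`_2 * u ^+ 2.
  by rewrite !hornerD hornerC !hornerZ hornerX hornerXn.
have gw : g w = p`_0.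
  have := gp 0; rewrite Normc.normc0 addr0 hE !expr0n/= !mulr0 !addr0.
  move=> /(_ d0) g0; apply/subr0_eq/Normc.eq0_normc/le_anti.
  by rewrite g0 normc_ge0.
set b := normc (g w).
have b0 : 0 <= b by exact: normc_ge0.
exists (8 * b * K), d; split; rewrite ?mulr_ge0// => t /andP[t0 td].
pose E u := g (w + u) - (p`_0 + p`_1 * u + p`_2 * u ^+ 2).
have Eb u : normc u = t -> normc (E u) <= K * t ^+ 3.
  by move=> ut; have := gp u; rewrite ut hE => /(_ td).
have nt : normc t%:C = t by rewrite normc_real gtr0_norm.
have nti : normc (t%:C * 'i) = t by rewrite Normc.normcM nt normc_i mulr1.
have E1 := Eb _ nt; have E3 := Eb _ nti.
have E2 : normc (E (- t%:C)) <= K * t ^+ 3 by apply: Eb; rewrite normcN.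
have E4 : normc (E (- (t%:C * 'i))) <= K * t ^+ 3 by apply: Eb; rewrite normcN.
have i2 : 'i ^+ 2 = -1 :> C by exact: sqr_i.
have sumE : 4 * g w = (g (w + t%:C) + g (w - t%:C) + g (w + t%:C * 'i) +
    g (w - t%:C * 'i)) - (E t%:C + E (- t%:C) + E (t%:C * 'i) +
    E (- (t%:C * 'i))).
  by rewrite /E gw !(sqrrN, exprMn) i2; ring.
have : 4 * b <= normc (g (w + t%:C)) + normc (g (w - t%:C)) +
    normc (g (w + t%:C * 'i)) + normc (g (w - t%:C * 'i)) + 4 * (K * t ^+ 3).
  have -> : 4 * b = normc (4 * g w).
    rewrite Normc.normcM (_ : 4 = (4 : R)%:C); last by rewrite rmorph_nat.
    by rewrite normc_real ger0_norm.
  rewrite sumE; apply: le_trans (le_normcD _ _) _; rewrite normcN.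
  apply: lerD.
    by do 3! (apply: le_trans (le_normcD _ _) _; apply: lerD => //).
  rewrite (_ : 4 * _ = K * t ^+ 3 + K * t ^+ 3 + K * t ^+ 3 + K * t ^+ 3);
    last by ring.
  by do 3! (apply: le_trans (le_normcD _ _) _; apply: lerD => //).
set x1 := normc (g _); set x2 := normc (g _); set x3 := normc (g _).
set x4 := normc (g _); move=> /(ler_wpM2l b0) h.
have := sqr_ge0 (x1 - b); have := sqr_ge0 (x2 - b).
have := sqr_ge0 (x3 - b); have := sqr_ge0 (x4 - b).
nra.
Qed.

(** If [|g z0| > B], then for small e the function [|g z|^2 + e |z|^2] exceeds at
    z0 its values on the circle, so its maximum over the disc is attained at an
    interior point w.  Averaging over four points at distance t from w,
    [|g|^2] loses at most [O(t^3)] while [e |z|^2] gains [e t^2]: a contradiction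
    for small t. *)
Lemma maximum_principle g (s B : R) : 0 < s ->
  (forall w, normc w <= s -> second_order g w) ->
  (forall w, normc w = s -> normc (g w) <= B) ->
  forall z, normc z <= s -> normc (g z) <= B.
Proof.
move=> s0 g2 gB z0 z0s; rewrite leNgt; apply/negP => gz0.
have B0 : 0 <= B.
  apply: le_trans (gB s%:C _); first exact: normc_ge0.
  by rewrite normc_real gtr0_norm.
have s20 : 0 < s ^+ 2 by rewrite exprn_gt0.
have gap : B ^+ 2 < normc (g z0) ^+ 2 by rewrite ltr_pXn2r// ?nnegrE ?normc_ge0.
(* Half of the largest e for which z0 still beats the circle. *)
pose e : R := (normc (g z0) ^+ 2 - B ^+ 2) / (2 * s ^+ 2).
have e0 : 0 < e by rewrite divr_gt0 ?subr_gt0// mulr_gt0.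
have es : e * s ^+ 2 < normc (g z0) ^+ 2 - B ^+ 2.
  rewrite (_ : e * _ = (normc (g z0) ^+ 2 - B ^+ 2) / 2); last first.
    by rewrite /e; field; lra.
  lra.
pose U z : R := normc (g z) ^+ 2 + e * normc z ^+ 2.
have [|w ws wmax] := @disc_max s U (ltW s0).
  move=> w ws r r0; have [p gp] := g2 _ ws.
  have [K [d [K0 d0 lip]]] := taylor_at_lipschitz (L := 3) isT gp.
  (* A Lipschitz constant of U at w, made positive by the last term. *)
  pose A := K * (2 * normc (g w) + K) + e * (2 * normc w + 1) + 1.
  have A0 : 0 < A.
    have A1 : 0 <= K * (2 * normc (g w) + K).
      by rewrite mulr_ge0// addr_ge0// mulr_ge0// normc_ge0.
    have A2 : 0 <= e * (2 * normc w + 1).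
      by rewrite mulr_ge0 ?(ltW e0)// addr_ge0// mulr_ge0// normc_ge0.
    by rewrite /A; lra.
  exists (Num.min (Num.min d 1) (r / A)).
    by rewrite !lt_min d0 ltr01 divr_gt0.
  move=> u; rewrite !lt_min -andbA => /and3P[/lip ud u1 ur].
  have u0 := normc_ge0 u; rewrite ltr_pdivlMr// in ur.
  apply: le_lt_trans ur.
  have h1 : `|normc (g (w + u)) ^+ 2 - normc (g w) ^+ 2| <=
      K * (2 * normc (g w) + K) * normc u.
    have xy := le_normcB (g (w + u)) (g w).
    have yx := le_normcB (g w) (g (w + u)); rewrite normcB in yx.
    have x0 := normc_ge0 (g (w + u)); have y0 := normc_ge0 (g w).
    have Ku : K * normc u <= K by rewrite ler_piMr// ltW.
    rewrite subr_sqr normrM (ger0_norm (addr_ge0 x0 y0)) mulrAC.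
    apply: ler_pM; rewrite ?addr_ge0//; last by lra.
    by rewrite ler_norml; apply/andP; split; lra.
  have h2 : `|e * normc (w + u) ^+ 2 - e * normc w ^+ 2| <=
      e * (2 * normc w + 1) * normc u.
    rewrite -mulrBr normrM (gtr0_norm e0) -mulrA ler_pM2l//.
    have xy : normc (w + u) <= normc w + normc u by exact: le_normcD.
    have yx : normc w <= normc (w + u) + normc u.
      have := le_normcB w (- u); rewrite opprK normcN; lra.
    have x0 := normc_ge0 (w + u); have y0 := normc_ge0 w.
    rewrite subr_sqr normrM (ger0_norm (addr_ge0 x0 y0)) mulrC.
    apply: ler_pM; rewrite ?addr_ge0//.
      by clear -xy u1; lra.
    rewrite ler_norml; apply/andP; split.
      by clear -yx; lra.
    by clear -xy; lra.
  rewrite /U (_ : _ - _ = (normc (g (w + u)) ^+ 2 - normc (g w) ^+ 2) +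
    (e * normc (w + u) ^+ 2 - e * normc w ^+ 2)); last by ring.
  apply: le_trans (ler_normD _ _) _; rewrite [leRHS]mulrC.
  apply: le_trans (lerD h1 h2) _; rewrite -mulrDl ler_wpM2r//.
  by rewrite /A lerDl.
have Uw : B ^+ 2 + e * s ^+ 2 < U w.
  apply: lt_le_trans (wmax _ z0s); rewrite /U.
  have : 0 <= e * normc z0 ^+ 2 by rewrite mulr_ge0 ?sqr_ge0// ltW.
  lra.
have ws' : normc w < s.
  rewrite lt_neqAle ws andbT; apply/eqP => wS; move: Uw; rewrite /U wS ltrD2r.
  by rewrite ltNge ler_pXn2r ?nnegrE ?normc_ge0// gB.
have [K [d [K0 d0 mean]]] := four_point_mean (g2 _ ws).
(* t is small enough for the four points to stay in the disc and for
   [K t^3] to be less than [e t^2]. *)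
pose t := Num.min (Num.min d (s - normc w)) (e / (K + 1)) / 2.
have K1 : 0 < K + 1 by lra.
have t'0 : 0 < Num.min (Num.min d (s - normc w)) (e / (K + 1)).
  by rewrite !lt_min d0 subr_gt0 ws'/= divr_gt0.
have t0 : 0 < t by rewrite /t; lra.
have : t < Num.min (Num.min d (s - normc w)) (e / (K + 1)) by rewrite /t; lra.
rewrite !lt_min -andbA => /and3P[td ts te].
rewrite ltr_pdivlMr// in te.
have nt : normc t%:C = t by rewrite normc_real gtr0_norm.
have nti : normc (t%:C * 'i) = t by rewrite Normc.normcM nt normc_i mulr1.
have wt u : normc u = t -> U (w + u) <= U w.
  by move=> ut; apply: wmax; apply: le_trans (le_normcD _ _) _; rewrite ut; lra.
have := wt _ nt; have := wt _ nti.
have := wt (- t%:C); have := wt (- (t%:C * 'i)); rewrite !normcN nt nti.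
move=> /(_ erefl) U1 /(_ erefl) U2 U3 U4.
have par : normc (w + t%:C) ^+ 2 + normc (w - t%:C) ^+ 2 +
   normc (w + t%:C * 'i) ^+ 2 + normc (w - t%:C * 'i) ^+ 2 =
   4 * normc w ^+ 2 + 4 * t ^+ 2.
  by case: (w) => a b; rewrite !sqr_normcE /=; ring.
have := mean t; rewrite t0 td => /(_ isT).
move: U1 U2 U3 U4; rewrite /U => U1 U2 U3 U4 m.
have : 4 * e * t ^+ 2 <= K * t ^+ 3.
  have : e * (4 * normc w ^+ 2 + 4 * t ^+ 2) =
    e * normc (w + t%:C) ^+ 2 + e * normc (w - t%:C) ^+ 2 +
   e * normc (w + t%:C * 'i) ^+ 2 + e * normc (w - t%:C * 'i) ^+ 2.
    by rewrite -par; ring.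
  lra.
rewrite (_ : K * t ^+ 3 = K * t * t ^+ 2); last by ring.
rewrite ler_pM2r ?exprn_gt0//; nra.
Qed.

End MaximumPrinciple.

(** * Cauchy estimates in one variable *)

Section RootsOfUnity.
Variable R : realType.
Local Notation C := R[i].

Lemma exists_primitive_root N : (0 < N)%N -> exists x : C, N.-primitive_root x.
Proof.
move=> N0; have [r /= Er] := closed_field_poly_normal ('X^N - 1 : {poly C}).
have lc : lead_coef ('X^N - 1 : {poly C}) = 1 by exact/monicP/monicXnsubC.
rewrite lc scale1r in Er.
have sr : size r = N.
  by apply: succn_inj; rewrite -(size_prod_XsubC r id) -Er size_XnsubC.
have /hasP[x _ px] : has N.-primitive_root r.
  apply: has_prim_root; rewrite ?sr//.
    apply/allP => x; rewrite -root_prod_XsubC -Er rootE unity_rootE.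
    by rewrite hornerD hornerN hornerXn hornerC subr_eq0.
  rewrite -separable_prod_XsubC -Er separable_Xn_sub_1//.
  by rewrite pnatr_eq0 -lt0n.
by exists x.
Qed.

Variables (N : nat) (x : C).
Hypothesis px : N.-primitive_root x.

Lemma normc_prim_root : normc x = 1.
Proof.
have N0 := prim_order_gt0 px.
have /eqP : normc x ^+ N = 1 by rewrite -normcX (prim_expr_order px) Normc.normc1.
by rewrite pexpr_eq1 ?normc_ge0// => /eqP.
Qed.

Lemma prim_root_neq0 : x != 0.
Proof.
by apply/eqP => x0; move: normc_prim_root; rewrite x0 Normc.normc0 => /eqP;
  rewrite eq_sym oner_eq0.
Qed.

(** Orthogonality of the characters of the cyclic group of order N: for k != l
    the sum is geometric, with ratio a nontrivial N-th root of unity. *)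
Lemma prim_root_orthogonal k l : (k < N)%N -> (l < N)%N ->
  \sum_(j < N) (x ^+ j) ^+ k * (x ^+ j) ^- l = (k == l)%:R * N%:R.
Proof.
move=> kN lN; have x0 := prim_root_neq0.
under eq_bigr do rewrite -!exprM [(_ * k)%N]mulnC [(_ * l)%N]mulnC !exprM -exprVn
  -exprMn.
case: eqVneq => [<-|kl].
  rewrite mul1r (eq_bigr (fun=> 1)) ?sumr_const ?card_ord// => j _.
  by rewrite mulfV ?expr1n// expf_neq0.
rewrite mul0r; set y := _ / _.
have y1 : y - 1 != 0.
  rewrite subr_eq0 -(inj_eq (mulIf (expf_neq0 l x0))) mul1r mulfVK ?expf_neq0//.
  by rewrite (eq_prim_root_expr px) !modn_small.
apply: (mulfI y1); rewrite mulr0 -subrX1 /y exprMn exprVn -!exprM.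
by rewrite ![(_ * N)%N]mulnC !exprM (prim_expr_order px) !expr1n invr1 mul1r subrr.
Qed.

End RootsOfUnity.

Section CauchyEstimates.
Variable R : realType.
Local Notation C := R[i].
Implicit Types (g : C -> C) (a : nat -> C).

(** Maximum principle for the remainder divided by [z^L], which extends to 0
    with value [a L].  Both conclusions are the same bound, at 0 and at z. *)
Lemma divided_remainder g a (s B : R) L : 0 < s ->
  (forall w, normc w <= s -> w != 0 -> second_order g w) ->
  (forall l, taylor_at g 0 (\poly_(k < l) a k) l) ->
  (forall w, normc w = s -> normc (g w - \sum_(k < L) a k * w ^+ k) <= B) ->
  normc (a L) * s ^+ L <= B /\ forall z, normc z <= s ->
    normc (g z - \sum_(k < L) a k * z ^+ k) * s ^+ L <= B * normc z ^+ L.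
Proof.
move=> s0 g2 ga gB.
pose p := \poly_(k < L) a k.
pose h z := if z == 0 then a L else (g z - p.[z]) * z ^- L.
have hB : forall z, normc z <= s -> normc (h z) <= B / s ^+ L.
  apply: maximum_principle => // w ws; last first.
    have w0 : w != 0.
      by apply/eqP => w0; move: s0; rewrite -ws w0 Normc.normc0 ltxx.
    rewrite /h (negPf w0) horner_poly Normc.normcM Normc.normcV normcX ws.
    by rewrite ler_wpM2r ?gB// invr_ge0 exprn_ge0// ltW.
  have [->|w0] := eqVneq w 0; last first.
    have [q hq] : second_order (fun z => (g z + (- p).[z]) * z ^- L) w.
      apply: second_orderM; last exact: second_orderVX.
      by apply: second_orderD; [exact: g2|eexists; exact: taylor_at_poly].
    exists q; apply: taylor_at_eq hq.
    exists (normc w); rewrite ?normc_gt0// => u uw.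
    rewrite /h hornerN ifF//; apply/eqP => wu.
    by move: uw; rewrite -[u]opprK -(addr0_eq wu) opprK normcN ltxx.
  exists (\poly_(k < 3) a (L + k)%N).
  have [K [d [K0 d0 gp]]] := ga (L + 3)%N.
  exists K, d; split => // u ud; rewrite add0r /h.
  have [->|u0] := eqVneq u 0.
    rewrite horner_coef0 coef_poly addn0 subrr Normc.normc0.
    by rewrite mulr_ge0 ?exprn_ge0 ?normc_ge0.
  rewrite -(ler_pM2r (exprn_gt0 L (normc_gt0 u0))) -mulrA -exprD (addnC 3).
  rewrite -normcX -Normc.normcM mulrBl mulfVK ?expf_neq0//.
  have := gp u ud; rewrite add0r !horner_poly big_split_ord/= opprD addrA.
  congr (normc (_ - _) <= _).
  by rewrite mulr_suml; apply: eq_bigr => i _; rewrite exprD; ring.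
split.
  rewrite -ler_pdivlMr ?exprn_gt0//.
  by have := hB 0; rewrite Normc.normc0 (ltW s0) /h eqxx; apply.
move=> z zs; rewrite -(horner_poly L a z) -/p.
have [->|z0] := eqVneq z 0; last first.
  have := hB _ zs; rewrite /h (negPf z0) Normc.normcM Normc.normcV normcX.
  by rewrite ler_pdivrMr ?exprn_gt0 ?normc_gt0// mulrAC -ler_pdivrMr
    ?invr_gt0 ?exprn_gt0// invrK.
have ga0 : g 0 = a 0%N.
  by rewrite (taylor_at_val (ga 1%N)) horner_poly big_ord1 expr0 mulr1.
rewrite Normc.normc0 ga0 horner_poly.
case: L @p @h hB {gB} => [|L] p h hB.
  rewrite big_ord0 subr0 !expr0 !mulr1.
  by have := hB 0; rewrite /h eqxx Normc.normc0 expr0 divr1; apply; rewrite ltW.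
rewrite big_ord_recl big1 => [|k _]; last by rewrite expr0n mulr0.
by rewrite expr0 mulr1 addr0 subrr Normc.normc0 mul0r expr0n mulr0.
Qed.

(** Averaging [y^-m g (y z)] over the (m+1)-th roots of unity y keeps the bound M
    and kills the coefficients of degree less than m, so that [divided_remainder]
    applies to the average without subtracting anything.  Bounding the partial
    sum directly would only give [2^m M]. *)
Lemma cauchy_estimate g a (s M : R) m : 0 < s ->
  (forall w, normc w <= s -> w != 0 -> second_order g w) ->
  (forall l, taylor_at g 0 (\poly_(k < l) a k) l) ->
  (forall w, normc w = s -> normc (g w) <= M) -> normc (a m) * s ^+ m <= M.
Proof.
move=> s0 g2 ga gM.
have [x px] := @exists_primitive_root R m.+1 isT.
have x1 := normc_prim_root px.
pose y (j : 'I_m.+1) := x ^+ j.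
have y1 j : normc (y j) = 1 by rewrite normcX x1 expr1n.
have y0 j : y j != 0 by rewrite expf_neq0// (prim_root_neq0 px).
pose G z := \sum_(j < m.+1) (y j) ^- m * g (y j * z).
pose b k := a k * \sum_(j < m.+1) (y j) ^+ k * (y j) ^- m.
have bE k : (k <= m)%N -> b k = (k == m)%:R * m.+1%:R * a k.
  by move=> km; rewrite /b prim_root_orthogonal// mulrC.
have [w ws w0|l|w ws|bound _] := @divided_remainder G b s (m.+1%:R * M) m s0.
- have /choice[p gp] : forall j : 'I_m.+1, exists p, taylor_at g (y j * w) p 3.
    by move=> j; apply: g2; rewrite ?mulf_neq0// Normc.normcM y1 mul1r.
  eexists; apply: taylor_at_sum => j; apply: taylor_atM (taylor_at_cst _ _ _) _.
  exact: taylor_at_rot (gp j).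
- have : taylor_at G 0 (\sum_(j < m.+1) ((y j) ^- m)%:P *
      ((\poly_(k < l) a k) \Po (y j *: 'X))) l.
    apply: taylor_at_sum => j; apply: taylor_atM (taylor_at_cst _ _ _) _.
    by apply: taylor_at_rot; rewrite ?mulr0.
  apply: taylor_at_trunc => i il; rewrite coef_sum coef_poly il /b mulr_sumr.
  apply: eq_bigr => j _; rewrite coefCM.
  by rewrite coef_comp_polyZX coef_poly il; ring.
- have -> : \sum_(k < m) b k * w ^+ k = 0.
    by apply: big1 => k _; rewrite bE ?(ltn_eqF (ltn_ord k)) ?mul0r// ltnW.
  rewrite subr0; apply: le_trans (normc_sum _ _ _) _.
  rewrite mulr_natl -[X in _ <= _ *+ X](card_ord m.+1) -sumr_const.
  apply: ler_sum => j _; rewrite Normc.normcM Normc.normcV normcX y1 expr1n.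
  by rewrite invr1 mul1r gM// Normc.normcM y1 mul1r.
move: bound; rewrite bE// eqxx mul1r Normc.normcM.
rewrite (_ : normc m.+1%:R = m.+1%:R).
  by rewrite -mulrA ler_pM2l// ltr0n.
have -> : m.+1%:R = (m.+1%:R : R)%:C by rewrite rmorph_nat.
by rewrite normc_real ger0_norm.
Qed.

(** Each of the L terms subtracted is at most M on the circle by Cauchy's
    estimate. *)
Lemma taylor_remainder g a (s M : R) L z : 0 < s ->
  (forall w, normc w <= s -> w != 0 -> second_order g w) ->
  (forall l, taylor_at g 0 (\poly_(k < l) a k) l) ->
  (forall w, normc w = s -> normc (g w) <= M) -> normc z <= s ->
  normc (g z - \sum_(k < L) a k * z ^+ k) <= L.+1%:R * M * (normc z / s) ^+ L.
Proof.
move=> s0 g2 ga gM zs.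
have [|_ /(_ z zs)] := @divided_remainder g a s (L.+1%:R * M) L s0 g2 ga.
  move=> w ws; rewrite -[L.+1]add1n natrD mulrDl mul1r.
  apply: le_trans (le_normcD _ _) _; rewrite normcN lerD ?gM//.
  apply: le_trans (normc_sum _ _ _) _.
  rewrite mulr_natl -[X in _ <= _ *+ X](card_ord L) -sumr_const.
  apply: ler_sum => j _; rewrite Normc.normcM normcX ws.
  exact: cauchy_estimate gM.
by rewrite expr_div_n mulrA ler_pdivlMr ?exprn_gt0//.
Qed.

End CauchyEstimates.

(** * Multi-indices, homogeneous parts and grids of roots of unity *)

Section MultiIndices.
Variables (R : realType) (n : nat).
Local Notation C := R[i].
Local Notation multiindex := (multiindex n).
Implicit Types (k l : multiindex) (z : 'rV[C]_n) (c d : multiindex -> C).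

Definition mdeg k : nat := \sum_(i < n) k i.

(** These sets are cofinal among the finite sets of multi-indices, so an
    unconditional sum is also a limit along them.  They are cut out of a box of
    exponents to be visibly finite. *)
Definition below L : {fset multiindex} :=
  [fset k in [seq [ffun i => (j i : nat)] | j : {ffun 'I_n -> 'I_L}] |
     (mdeg k < L)%N]%fset.

Lemma mdeg_ge k i : (k i <= mdeg k)%N.
Proof. by rewrite /mdeg (bigD1 i)//= leq_addr. Qed.

Lemma in_below L k : (k \in below L) = (mdeg k < L)%N.
Proof.
rewrite !inE /=; apply: andb_idl => kL; apply/mapP.
exists [ffun i => Ordinal (leq_ltn_trans (mdeg_ge k i) kL)].
  by rewrite mem_enum.
by apply/ffunP => i; rewrite !ffunE.
Qed.

Lemma fset_below (A : {fset multiindex}) : exists L, (A `<=` below L)%fset.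
Proof.
exists (\sum_(k <- A) (mdeg k).+1)%N.
apply/fsubsetP => k kA; rewrite in_below (big_fsetD1 k)//=.
by rewrite addSn ltnS leq_addr.
Qed.

Lemma below_subset L L' : (L <= L')%N -> (below L `<=` below L')%fset.
Proof.
move=> LL; apply/fsubsetP => k; rewrite !in_below => kL; exact: leq_trans LL.
Qed.

Lemma partial_sumE (u : multiindex -> C) (A : {fset multiindex}) :
  summability.partial_sum (u : multiindex -> C^o) A = \sum_(k <- A) u k.
Proof. by rewrite big_seq_fsetE. Qed.

Lemma sum_below_widen (F : multiindex -> C) L m : (m < L)%N ->
  \sum_(k <- below L | mdeg k == m) F k =
  \sum_(k <- below m.+1 | mdeg k == m) F k.
Proof.
move=> mL; rewrite -[LHS]big_filter -[RHS]big_filter; apply: perm_big.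
apply: uniq_perm; rewrite ?filter_uniq ?fset_uniq// => k.
rewrite !mem_filter !in_below; case: eqP => //= ->.
by rewrite ltnSn mL.
Qed.

Lemma sum_below_degree (F : multiindex -> C) L :
  \sum_(k <- below L) F k =
  \sum_(m < L) \sum_(k <- below m.+1 | mdeg k == m) F k.
Proof.
elim: L => [|L IHL].
  rewrite big_ord0 big1_seq// => k; rewrite andTb.
  by have := in_below 0 k; rewrite ltn0 => ->.
rewrite big_ord_recr/= -IHL (bigID (fun k => mdeg k == L))/= addrC; congr (_ + _).
rewrite -[LHS]big_filter; apply: perm_big.
apply: uniq_perm; rewrite ?filter_uniq ?fset_uniq// => k.
by rewrite mem_filter !in_below ltnS leq_eqVlt; case: ltngtP.
Qed.

(** The homogeneous part of degree m of the series with coefficients c. *)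
Definition hpart c m z : C :=
  \sum_(k <- below m.+1 | mdeg k == m) c k * monomial z k.

Lemma sum_hpart c L z :
  \sum_(k <- below L) c k * monomial z k = \sum_(m < L) hpart c m z.
Proof. exact: sum_below_degree. Qed.

Lemma monomialZ (u : C) z k : monomial (u *: z) k = u ^+ mdeg k * monomial z k.
Proof.
rewrite /monomial /mdeg -prodrXr -big_split/=; apply: eq_bigr => i _.
by rewrite mxE exprMn.
Qed.

Lemma hpartZ c m (u : C) z : hpart c m (u *: z) = hpart c m z * u ^+ m.
Proof.
rewrite /hpart mulr_suml; apply: eq_bigr => k /eqP <-.
by rewrite monomialZ [u ^+ _ * _]mulrC mulrA.
Qed.

Definition madd k l : multiindex := [ffun i => (k i + l i)%N].

Lemma mdegD k l : mdeg (madd k l) = (mdeg k + mdeg l)%N.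
Proof. by rewrite /mdeg -big_split; apply: eq_bigr => i _; rewrite ffunE. Qed.

Lemma monomialD z k l : monomial z (madd k l) = monomial z k * monomial z l.
Proof.
by rewrite /monomial -big_split; apply: eq_bigr => i _; rewrite ffunE exprD.
Qed.

(** Coefficients of the product of two series; the degree bound is that of k
    because [madd i j = k] forces both degrees to be at most that of k. *)
Definition convolution c d k : C :=
  \sum_(i <- below (mdeg k).+1) \sum_(j <- below (mdeg k).+1)
    if madd i j == k then c i * d j else 0.

Lemma hpart_convolution c d m z :
  hpart (convolution c d) m z = \sum_(a < m.+1) hpart c a z * hpart d (m - a) z.
Proof.
transitivity (\sum_(i <- below m.+1) \sum_(j <- below m.+1)
    if (mdeg i + mdeg j == m)%N
    then (c i * monomial z i) * (d j * monomial z j) else 0).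
  transitivity (\sum_(k <- below m.+1 | mdeg k == m) \sum_(i <- below m.+1)
      \sum_(j <- below m.+1)
      if madd i j == k then (c i * monomial z i) * (d j * monomial z j) else 0).
    apply: eq_bigr => k /eqP km; rewrite /convolution km mulr_suml.
    apply: eq_bigr => i _; rewrite mulr_suml; apply: eq_bigr => j _.
    by case: eqP => [<-|_]; rewrite ?mul0r// monomialD; ring.
  rewrite exchange_big; apply: eq_bigr => i _.
  rewrite exchange_big; apply: eq_bigr => j _.
  rewrite -big_mkcondr/= -mdegD; case: eqP => ijm; last first.
    by rewrite big1// => k /andP[/eqP km /eqP ijk]; case: ijm; rewrite ijk.
  rewrite -big_filter (@perm_big _ _ _ _ _ [:: madd i j]) ?big_seq1//.
  apply: uniq_perm; rewrite ?filter_uniq ?fset_uniq// => k.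
  rewrite mem_filter in_below inE; have [->|kij] := eqVneq k (madd i j).
    by rewrite ijm eqxx ltnSn.
  by rewrite andbF.
transitivity (\sum_(a < m.+1) (\sum_(i <- below m.+1 | mdeg i == a)
  \sum_(j <- below m.+1 | mdeg j == (m - a)%N)
   (c i * monomial z i) * (d j * monomial z j))).
  under [RHS]eq_bigr do rewrite big_mkcond.
  rewrite [RHS]exchange_big; apply: eq_bigr => i _.
  under [RHS]eq_bigr do rewrite big_mkcond.
  rewrite -[RHS]big_mkcond/=.
  rewrite [RHS]exchange_big; apply: eq_bigr => j _.
  rewrite -big_mkcondr/=.
  have [ijm|ijm] := eqP.
    have im : (mdeg i < m.+1)%N by rewrite ltnS -ijm leq_addr.
    rewrite (big_pred1 (Ordinal im))// => a.
    apply/andP/eqP => [[/eqP ia _]|->/=]; first exact/val_inj.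
    by rewrite -ijm addKn.
  rewrite big1// => a /andP[/eqP ia /eqP ja]; case: ijm.
  by rewrite ia ja subnKC// -ltnS.
apply: eq_bigr => a _; rewrite /hpart.
rewrite (sum_below_widen _ (ltn_ord a)).
rewrite mulr_suml; apply: eq_bigr => i _; rewrite mulr_sumr.
by rewrite sum_below_widen// ltnS leq_subr.
Qed.

End MultiIndices.

Section GridParseval.
Variables (R : realType) (n : nat).
Local Notation C := R[i].
Variables (N : nat) (x : C).
Hypothesis px : N.-primitive_root x.

Definition grid_point (j : {ffun 'I_n -> 'I_N}) : 'rV[C]_n :=
  \row_i x ^+ j i.

Lemma normc_grid_point j i : normc (grid_point j 0 i) = 1.
Proof. by rewrite mxE normcX (normc_prim_root px) expr1n. Qed.

(** The sum over the grid factors into n one-variable sums, one per coordinate. *)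
Lemma grid_orthogonal (k l : multiindex n) :
  (forall i, (k i < N)%N) -> (forall i, (l i < N)%N) ->
  \sum_j monomial (grid_point j) k * (monomial (grid_point j) l)^* =
  (k == l)%:R * N%:R ^+ n.
Proof.
move=> kN lN.
have -> : (k == l)%:R * N%:R ^+ n = \prod_(i < n) ((k i == l i)%:R * N%:R) :> C.
  rewrite big_split/= prodr_const card_ord; congr (_ * _).
  case: eqVneq => [->|kl]; first by rewrite big1// => i _; rewrite eqxx.
  have [i kli] : exists i, k i != l i.
    apply/existsP; rewrite -negb_forall; apply: contra_neqN kl => /forallP kl.
    by apply/ffunP => i; exact/eqP.
  by rewrite (bigD1 i)//= (negPf kli) mul0r.
under [RHS]eq_bigr do rewrite -(prim_root_orthogonal px)//.
rewrite bigA_distr_bigA; apply: eq_bigr => j _.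
rewrite /monomial rmorph_prod -big_split/=; apply: eq_bigr => i _.
by rewrite rmorphXn/= conjc_unit ?normc_grid_point// mxE exprVn.
Qed.

(** A discrete Parseval identity: on a grid of N-th roots of unity the monomials
    with exponents less than N are orthogonal. *)
Lemma grid_parseval (A : {fset multiindex n}) (b : multiindex n -> C) :
  (forall k, k \in A -> forall i, (k i < N)%N) ->
  \sum_(j : {ffun 'I_n -> 'I_N})
     normc (\sum_(k <- A) b k * monomial (grid_point j) k) ^+ 2 =
  N%:R ^+ n * \sum_(k <- A) normc (b k) ^+ 2.
Proof.
move=> AN; apply: complexI; rewrite rmorphM rmorphXn !rmorph_sum rmorph_nat/=.
under eq_bigr do rewrite sqr_normcC rmorph_sum/= mulr_suml.
rewrite exchange_big/= mulr_sumr big_seq [RHS]big_seq.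
apply: eq_bigr => k kA; rewrite sqr_normcC.
under eq_bigr do rewrite mulr_sumr.
have orth l : l \in A -> \sum_j b k * monomial (grid_point j) k *
    (b l * monomial (grid_point j) l)^* = b k * (b l)^* * ((k == l)%:R * N%:R ^+ n).
  move=> lA; rewrite -(grid_orthogonal (AN _ kA) (AN _ lA)) mulr_sumr.
  by apply: eq_bigr => j _; rewrite rmorphM/=; ring.
rewrite exchange_big/= (big_fsetD1 k)//= orth// eqxx mul1r [RHS]mulrC.
rewrite [X in _ + X]big1_seq ?addr0// => l; rewrite andTb in_fsetD1 => /andP[lk lA].
by rewrite orth// eq_sym (negPf lk) mul0r mulr0.
Qed.

End GridParseval.

(** * Unconditional sums *)

Section UnconditionalSums.
Variables (R : realType) (n : nat).
Local Notation C := R[i].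
Local Notation multiindex := (multiindex n).
Implicit Types (u v : multiindex -> C) (A B : {fset multiindex}).

Lemma has_sumP u (l : C) : has_sum u l <-> forall e : R, 0 < e ->
  exists A, forall B, (A `<=` B)%fset -> normc (\sum_(k <- B) u k - l) < e.
Proof.
rewrite /has_sum; split.
  move=> /cvgrPdist_lt ul e e0.
  have [|A _ Ae] := ul e%:C; first by rewrite ltcR.
  exists A => B /Ae /=; rewrite partial_sumE abs_normc ltcR.
  by rewrite normcB.
move=> ul; apply/cvgrPdist_lt => e e0.
have eE : e = (complex.Re e)%:C by rewrite RRe_real// gtr0_real.
have [|A Ae] := ul (complex.Re e); first by rewrite -ltcR -eE.
exists A => // B AB /=; rewrite partial_sumE abs_normc eE ltcR normcB.
exact: Ae.
Qed.

Lemma has_sum_unique u (l l' : C) : has_sum u l -> has_sum u l' -> l = l'.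
Proof.
move=> /has_sumP ul /has_sumP ul'.
apply/subr0_eq/Normc.eq0_normc/le_anti; rewrite normc_ge0 andbT.
apply/ler_addgt0Pr => e e0; rewrite add0r.
have e20 : 0 < e / 2 by lra.
have [A Ae] := ul _ e20; have [B Be] := ul' _ e20.
have := Ae (A `|` B)%fset (fsubsetUl _ _); have := Be (A `|` B)%fset (fsubsetUr _ _).
set s := \sum_(_ <- _) _ => h1 h2.
have -> : l - l' = - (s - l) + (s - l') by ring.
apply: le_trans (le_normcD _ _) _; rewrite normcN; lra.
Qed.

Lemma eq_has_sum u v l : u =1 v -> has_sum u l -> has_sum v l.
Proof. by move=> /funext ->. Qed.

Lemma has_sumZD (a : C) u v l l' : has_sum u l -> has_sum v l' ->
  has_sum (fun k => a * u k + v k) (a * l + l').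
Proof.
move=> /has_sumP ul /has_sumP vl; apply/has_sumP => e e0.
have a1 : 0 < normc a + 1 by have := normc_ge0 a; lra.
have e1 : 0 < e / 2 / (normc a + 1) by rewrite divr_gt0//; lra.
have e2 : 0 < e / 2 by lra.
have [A Ae] := ul _ e1; have [B Be] := vl _ e2.
exists (A `|` B)%fset => D; rewrite fsubUset => /andP[AD BD].
have := Ae _ AD; have := Be _ BD; rewrite (ltr_pdivlMr _ _ a1) big_split/= -mulr_sumr.
set t := \sum_(_ <- _) _; set s := \sum_(_ <- _) _ => ht hs.
have -> : a * s + t - (a * l + l') = a * (s - l) + (t - l') by ring.
apply: le_lt_trans (le_normcD _ _) _; rewrite Normc.normcM.
have := normc_ge0 (s - l); clear -hs ht; rewrite mulrDr mulr1 mulrC in hs; lra.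
Qed.

Lemma has_sum_conj u l : has_sum u l -> has_sum (fun k => (u k)^*) l^*.
Proof.
move=> /has_sumP ul; apply/has_sumP => e /ul[A Ae]; exists A => B /Ae.
rewrite -rmorph_sum -rmorphB/=.
by case: (_ - _) => a b /=; rewrite sqrrN.
Qed.

Lemma has_sum_below u l : has_sum u l -> forall e : R, 0 < e ->
  exists L0, forall L, (L0 <= L)%N -> normc (\sum_(k <- below n L) u k - l) < e.
Proof.
move=> /has_sumP ul e /ul[A Ae]; have [L0 AL0] := fset_below A.
exists L0 => L LL; apply: Ae; apply: fsubset_trans AL0 _.
exact: below_subset.
Qed.

Definition abs_bounded u := exists K : R, forall A, \sum_(k <- A) normc (u k) <= K.

Lemma le_abs_bounded u v : (forall k, normc (u k) <= normc (v k)) ->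
  abs_bounded v -> abs_bounded u.
Proof.
by move=> uv [K vK]; exists K => A; apply: le_trans (vK A); exact: ler_sum.
Qed.

Lemma sum_fset_le (F : multiindex -> R) A B : (forall k, 0 <= F k) ->
  (A `<=` B)%fset -> \sum_(k <- A) F k <= \sum_(k <- B) F k.
Proof.
move=> F0 AB; rewrite (big_fsetID _ (mem A) B)/=.
rewrite (_ : [fset x in B | x \in A]%fset = A) ?lerDl ?sumr_ge0//.
apply/fsetP => k; rewrite !inE/=; apply: andb_idl.
exact: (fsubsetP AB).
Qed.

(** The sum is the supremum of the finite partial sums. *)
Lemma has_sum_nonneg (F : multiindex -> R) : (forall k, 0 <= F k) ->
  abs_bounded (fun k => (F k)%:C) -> exists2 l : R, 0 <= l &
    has_sum (fun k => (F k)%:C) l%:C /\ forall A, \sum_(k <- A) F k <= l.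
Proof.
move=> F0 [K FK].
pose S := [set \sum_(k <- A) F k | A in [set: {fset multiindex}]].
have S0 : has_sup S.
  split; first by exists (\sum_(k <- fset0) F k), fset0.
  exists K => _ [A _ <-]; apply: le_trans (FK A); apply: ler_sum => k _.
  by rewrite normc_real ger0_norm.
have SA A : \sum_(k <- A) F k <= sup S by apply: (ub_le_sup S0.2); exists A.
exists (sup S); first by apply: le_trans (SA fset0); rewrite big_seq_fset0.
split=> //; apply/has_sumP => e e0.
have [_ [A _ <-] Ae] := sup_adherent e0 S0.
exists A => B AB; rewrite -rmorph_sum -rmorphB normc_real ltr_norml.
have := SA B; have := sum_fset_le F0 AB => /= AB1 AB2; apply/andP; split; lra.
Qed.

(** Split into the positive and negative parts of the real and imaginary parts. *)
Lemma abs_bounded_has_sum u : abs_bounded u -> exists l, has_sum u l.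
Proof.
move=> ub.
have part (F : multiindex -> R) : (forall k, `|F k| <= normc (u k)) ->
    exists l, has_sum (fun k => (F k)%:C) l.
  move=> Fu.
  have [||l _ [Fl _]] := @has_sum_nonneg (fun k => (`|F k| + F k) / 2).
  - by move=> k; have := ler_norm (- F k); rewrite normrN; lra.
  - apply: le_abs_bounded ub => k; rewrite normc_real.
    have := Fu k; have := ler_norm (- F k); have := ler_norm (F k).
    by rewrite normrN => *; rewrite ger0_norm; lra.
  have [||l' _ [Fl' _]] := @has_sum_nonneg (fun k => (`|F k| - F k) / 2).
  - by move=> k; have := ler_norm (F k); lra.
  - apply: le_abs_bounded ub => k; rewrite normc_real.
    have := Fu k; have := ler_norm (- F k); have := ler_norm (F k).
    by rewrite normrN => *; rewrite ger0_norm; lra.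
  exists (-1 * l'%:C + l%:C).
  have := has_sumZD (a := -1) Fl' Fl; apply: eq_has_sum => k.
  by rewrite mulN1r addrC -rmorphB; congr _%:C; field.
have [l lu] := part (fun k => complex.Re (u k)) (fun k => ge_normc_Re _).
have [l' lu'] := part (fun k => complex.Im (u k)) (fun k => ge_normc_Im _).
exists ('i * l' + l); have := has_sumZD (a := 'i) lu' lu; apply: eq_has_sum => k.
by rewrite addrC -complexE.
Qed.

(** Once unconditional convergence is known, the sum can be computed along the
    sets [below L] only. *)
Lemma has_sum_of_below u l : abs_bounded u ->
  (forall e : R, 0 < e -> exists L0, forall L, (L0 <= L)%N ->
    normc (\sum_(k <- below n L) u k - l) < e) -> has_sum u l.
Proof.
move=> /abs_bounded_has_sum[l' ul'] ul.
suff -> : l = l' by [].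
apply/subr0_eq/Normc.eq0_normc/le_anti; rewrite normc_ge0 andbT.
apply/ler_addgt0Pr => e e0; rewrite add0r.
have e20 : 0 < e / 2 by lra.
have [L0 Le] := ul _ e20; have [L1 Le'] := has_sum_below ul' e20.
have := Le (maxn L0 L1) (leq_maxl _ _); have := Le' (maxn L0 L1) (leq_maxr _ _).
set s := \sum_(_ <- _) _ => h1 h2.
have -> : l - l' = - (s - l) + (s - l') by ring.
apply: le_trans (le_normcD _ _) _; rewrite normcN; lra.
Qed.

Lemma square_summableP u : square_summable u <->
  exists K : R, forall A, \sum_(k <- A) normc (u k) ^+ 2 <= K.
Proof.
split.
  rewrite /square_summable => uoo.
  exists (fine (\esum_(k in [set: multiindex]) (normc (u k) ^+ 2)%:E)) => A.
  rewrite -lee_fin fineK; last first.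
    rewrite ge0_fin_numE// esum_ge0// => k _.
    by rewrite lee_fin sqr_ge0.
  apply: ereal_sup_ubound; exists [set` A] => //.
  by rewrite fsbig_finite//= set_fsetK sumEFin.
move=> [K uK]; apply: le_lt_trans (ltry K).
apply: ge_ereal_sup => _ [A [Afin _] <-].
by rewrite fsbig_finite//= sumEFin lee_fin.
Qed.

Lemma square_summable_prod u v : square_summable u -> square_summable v ->
  abs_bounded (fun k => u k * v k).
Proof.
move=> /square_summableP[K uK] /square_summableP[K' vK'].
exists (K + K') => A; apply: le_trans (lerD (uK A) (vK' A)).
rewrite -big_split; apply: ler_sum => k _; rewrite Normc.normcM /=.
have := sqr_ge0 (normc (u k) - normc (v k)); have := normc_ge0 (u k).
have := normc_ge0 (v k); nra.
Qed.

End UnconditionalSums.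

(** * Slices of analytic functions of several variables *)

Section SeriesTaylor.
Variable R : realType.
Local Notation C := R[i].

(** Convergence at one point [r / 2] bounds [|a m| (r / 2)^m] by some K, so
    for [|u| <= r / 4] the tail from L on is dominated by a geometric series of
    ratio at most 1/2. *)
Lemma series_taylor (g : C -> C) w (a : nat -> C) (r : R) : 0 < r ->
  (forall u, normc u < r -> forall e : R, 0 < e -> exists L0, forall L,
    (L0 <= L)%N -> normc (\sum_(k < L) a k * u ^+ k - g (w + u)) < e) ->
  forall L, taylor_at g w (\poly_(k < L) a k) L.
Proof.
move=> r0 ag L; pose q := r / 2.
have q0 : 0 < q by rewrite /q; lra.
have nq : normc q%:C = q by rewrite normc_real gtr0_norm.
have [|L0 aL0] := ag q%:C _ 1 ltr01; first by rewrite nq /q; lra.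
(* From L0 on, a term is the difference of two partial sums within 1 of g. *)
pose K := 2 + \sum_(m < L0) normc (a m) * q ^+ m.
have K0 : 0 <= K.
  by rewrite addr_ge0// sumr_ge0// => i _; rewrite mulr_ge0 ?exprn_ge0 ?normc_ge0// ltW.
have aK m : normc (a m) * q ^+ m <= K.
  have [mL0|L0m] := ltnP m L0.
    rewrite /K (bigD1 (Ordinal mL0))//= addrCA lerDl addr_ge0// sumr_ge0// => i _.
    by rewrite mulr_ge0 ?exprn_ge0 ?normc_ge0// ltW.
  apply: (@le_trans _ _ 2); last first.
    by rewrite lerDl sumr_ge0// => i _; rewrite mulr_ge0 ?exprn_ge0 ?normc_ge0// ltW.
  rewrite -nq -normcX -Normc.normcM.
  have := aL0 _ L0m; have := aL0 _ (leqW L0m); rewrite big_ord_recr/=.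
  set s := \sum_(_ < _) _; set t := a m * _; set y := g _ => h1 h2.
  have -> : t = (s + t - y) - (s - y) by ring.
  apply: le_trans (le_normcD _ _) _; rewrite normcN; lra.
exists (2 * K / q ^+ L), (q / 2); split;
  rewrite ?divr_ge0 ?mulr_ge0 ?exprn_ge0//; try lra.
move=> u uq; rewrite horner_poly.
pose x := normc u / q.
have x0 : 0 <= x by rewrite divr_ge0 ?normc_ge0// ltW.
have x2 : x <= 1 / 2 by rewrite ler_pdivrMr//; lra.
(* The sharper bound with [2 - 2 x^M] makes the induction on M go through. *)
have tail M : normc (\sum_(k < L + M) a k * u ^+ k - \sum_(k < L) a k * u ^+ k) <=
    K * x ^+ L * (2 - 2 * x ^+ M).
  elim: M => [|M IHM].
    by rewrite addn0 subrr Normc.normc0 expr0 mulr1 subrr mulr0.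
  rewrite addnS big_ord_recr/= addrAC; apply: le_trans (le_normcD _ _) _.
  apply: le_trans (lerD IHM (_ : _ <= K * x ^+ (L + M))) _.
    rewrite Normc.normcM normcX /x expr_div_n mulrA ler_pdivlMr ?exprn_gt0//.
    by rewrite mulrAC ler_wpM2r ?exprn_ge0 ?normc_ge0.
  rewrite exprD mulrA -mulrDr ler_wpM2l ?mulr_ge0 ?exprn_ge0//.
  rewrite exprS; have := exprn_ge0 M x0; nra.
have ur : normc u < r by rewrite /q in uq; lra.
apply/ler_addgt0Pr => e e0; have [L1 gL1] := ag u ur e e0.
have := gL1 _ (leq_addl L L1); have := tail L1.
set s := \sum_(_ < _) _; set t := \sum_(_ < _) _ => h1 h2.
have -> : g (w + u) - t = (s - t) - (s - g (w + u)) by ring.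
apply: le_trans (le_normcD _ _) _; rewrite normcN lerD ?(ltW h2)//.
apply: le_trans h1 _; rewrite /x expr_div_n.
have -> : 2 * K / q ^+ L * normc u ^+ L = K * (normc u ^+ L / q ^+ L) * 2 by ring.
apply: ler_wpM2l; last by rewrite gerBl mulr_ge0// exprn_ge0.
by rewrite -expr_div_n mulr_ge0// exprn_ge0.
Qed.

End SeriesTaylor.

Section Slices.
Variables (R : realType) (n : nat).
Local Notation C := R[i].
Local Notation multiindex := (multiindex n).
Implicit Types (f g : polydisc R n -> C) (c d : multiindex -> C).
Implicit Types (z : 'rV[C]_n).

Definition in_polydisc z := forall i, normc (z 0 i) < 1.

Lemma polydisc_in (w : polydisc R n) : in_polydisc (polydisc_val w).
Proof.
by move=> i; have /forallP/(_ i) := valP w; rewrite abs_normc -ltcR.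
Qed.

Lemma in_polydiscP z : in_polydisc z -> exists w : polydisc R n, polydisc_val w = z.
Proof.
move=> zD; have zP : [forall i, `|z 0 i| < 1].
  by apply/forallP => i; rewrite abs_normc ltcR.
by exists (Polydisc zP).
Qed.

Lemma extend_val f (w : polydisc R n) : extend f (polydisc_val w) = f w.
Proof. by rewrite /extend (valK w). Qed.

Lemma polydisc_radius z : in_polydisc z -> exists r : R,
  [/\ 0 < r, r < 1 & forall i, normc (z 0 i) <= r].
Proof.
(* The default 1/2 keeps r positive, and covers n = 0. *)
move=> zD; exists (\big[Num.max/(1 / 2)]_(i < n) normc (z 0 i)); split.
- by apply: lt_le_trans (bigmax_ge_id _ _ _ _); lra.
- by apply: bigmax_lt => //; lra.
- by move=> i; exact: le_bigmax.
Qed.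

Definition slice f z (u : C) : C := extend f (u *: z).

(** Just enough regularity along the complex lines through the origin for the
    one-variable estimates, with coefficients c common to all lines.  Unlike the
    existence of local power series, it is visibly stable under products. *)
Definition slice_analytic f c :=
  (forall z u, in_polydisc (u *: z) -> second_order (slice f z) u) /\
  (forall z L, taylor_at (slice f z) 0 (\poly_(m < L) hpart c m z) L).

(** On the line through z the local series at [w = u z] becomes, when grouped by
    degree, a power series in one variable. *)
Lemma local_series_slice f (w : polydisc R n) (r : R) c : 0 < r ->
  (forall z : polydisc R n, (forall i, `|z 0 i - w 0 i| < r%:C) ->
    has_sum (fun k => c k * monomial (polydisc_val z - polydisc_val w) k) (f z)) ->
  forall z u, polydisc_val w = u *: z -> forall L,
    taylor_at (slice f z) u (\poly_(m < L) hpart c m z) L.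
Proof.
move=> r0 fc z u wuz.
have [s [s0 s1 ws]] := polydisc_radius (polydisc_in w).
pose Z := 1 + \sum_i normc (z 0 i).
have sum0 : 0 <= \sum_i normc (z 0 i) by apply: sumr_ge0 => i _; exact: normc_ge0.
have Z0 : 0 < Z by rewrite /Z; lra.
have zZ i : normc (z 0 i) <= Z.
  rewrite /Z (bigD1 i)//= addrCA lerDl addr_ge0// sumr_ge0// => j _.
  exact: normc_ge0.
apply: (@series_taylor _ _ _ _ (Num.min r (1 - s) / Z)).
  by rewrite divr_gt0// lt_min r0/=; lra.
move=> v; rewrite ltr_pdivlMr// lt_min => /andP[vr vs].
have vz i : normc (v * z 0 i) <= normc v * Z.
  by rewrite Normc.normcM ler_wpM2l ?normc_ge0.
have [|y yE] := @in_polydiscP ((u + v) *: z).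
  move=> i; rewrite scalerDl -wuz mxE; apply: le_lt_trans (le_normcD _ _) _.
  by rewrite mxE; have := vz i; have := ws i; lra.
have yw : polydisc_val y - polydisc_val w = v *: z.
  by rewrite yE wuz scalerDl addrC addKr.
have /fc yc : forall i, `|y 0 i - w 0 i| < r%:C.
  move=> i; have -> : y 0 i - w 0 i = v * z 0 i.
    by have := congr1 (fun A : 'rV__ => A 0 i) yw; rewrite !mxE.
  by rewrite abs_normc ltcR; apply: le_lt_trans (vz i) vr.
move=> e /(has_sum_below yc)[L0 Le].
exists L0 => L /Le; rewrite yw sum_hpart /slice -yE extend_val.
by under eq_bigr do rewrite hpartZ.
Qed.

Lemma analytic_slice f : analytic f -> exists c, slice_analytic f c.
Proof.
move=> fan.
have [|o oE] := @in_polydiscP 0.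
  by move=> i; rewrite mxE Normc.normc0.
have [r [c [r0 fc]]] := fan o; exists c; split; last first.
  by move=> z L; apply: (local_series_slice r0 fc); rewrite oE scale0r.
move=> z u /in_polydiscP[w wE]; have [s [d [s0 fd]]] := fan w.
by exists (\poly_(m < 3) hpart d m z); apply: (local_series_slice s0 fd).
Qed.

(** Only the germs multiply: truncated Taylor polynomials are multiplied slice by
    slice, and [convolution] collects the coefficients of the product. *)
Lemma slice_analyticM f g c d : slice_analytic f c -> slice_analytic g d ->
  slice_analytic (fun w => f w * g w) (convolution c d).
Proof.
move=> [f2 fc] [g2 gd].
have sliceM z : slice (fun w => f w * g w) z = (fun u => slice f z u * slice g z u).
  apply/funext => u; rewrite /slice /extend.
  by case: insubP => [w _ _|_] //=; rewrite mulr0.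
split=> [z u uz|z L]; rewrite sliceM.
  by apply: second_orderM; [exact: f2|exact: g2].
apply: taylor_at_trunc (taylor_atM (fc z L) (gd z L)) => i iL.
rewrite coefM coef_poly iL hpart_convolution; apply: eq_bigr => j _.
have jL : (j < L)%N by apply: leq_ltn_trans iL; rewrite -ltnS.
have ijL : (i - j < L)%N by apply: leq_ltn_trans iL; exact: leq_subr.
by rewrite !coef_poly jL ijL.
Qed.

End Slices.

(** * Bounded functions have square-summable expansions *)

Section RealEstimates.
Variable R : realType.
Implicit Types (x y e : R).

(** [y^L] is the least of the first [L + 1] terms of the geometric series. *)
Lemma natM_expr_le y L : 0 <= y < 1 -> L.+1%:R * y ^+ L <= (1 - y)^-1.
Proof.
move=> /andP[y0 y1].
have y1' : 0 < 1 - y by lra.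
rewrite -[leRHS]mul1r ler_pdivlMr//.
have -> : L.+1%:R * y ^+ L * (1 - y) = (\sum_(i < L.+1) y ^+ L) * (1 - y).
  by rewrite sumr_const card_ord mulr_natl.
apply: (@le_trans _ _ ((\sum_(i < L.+1) y ^+ i) * (1 - y))).
  rewrite ler_wpM2r ?(ltW y1')//; apply: ler_sum => i _.
  by rewrite ler_wiXn2l ?(ltW y1)// -ltnS.
rewrite -[_ * _]opprK -mulrN opprB mulrC -subrX1 opprB gerBl.
exact: exprn_ge0.
Qed.

Lemma expr_decay x e : 0 <= x < 1 -> 0 < e ->
  exists L0, forall L, (L0 <= L)%N -> L.+1%:R * x ^+ L <= e.
Proof.
(* By the arithmetic-geometric mean inequality [x <= y^2], so one factor y^L
   absorbs [L + 1] and the other decays. *)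
move=> /andP[x0 x1] e0; pose y := (1 + x) / 2.
have y0 : 0 <= y by rewrite /y; lra.
have y1 : y < 1 by rewrite /y; lra.
have y1' : 0 < 1 - y by lra.
have xy : x <= y ^+ 2 by rewrite /y; have := sqr_ge0 (1 - x); nra.
pose B := (1 - y)^-1 ^+ 2 / e.
have B0 : 0 <= B by rewrite divr_ge0 ?exprn_ge0 ?invr_ge0 ?(ltW y1') ?(ltW e0).
exists (Num.bound B) => L BL.
have BL' : B <= L.+1%:R.
  apply: ltW; apply: lt_le_trans (archi_boundP B0) _.
  by rewrite ler_nat leqW.
have L0 : 0 < L.+1%:R :> R by rewrite ltr0n.
rewrite -(ler_pM2r L0).
apply: (@le_trans _ _ ((L.+1%:R * y ^+ L) ^+ 2)).
  rewrite exprMn -exprM mulnC exprM mulrAC -expr2 ler_wpM2l ?exprn_ge0//.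
  by rewrite lerXn2r ?nnegrE ?exprn_ge0.
apply: (@le_trans _ _ ((1 - y)^-1 ^+ 2)).
  rewrite lerXn2r ?nnegrE ?mulr_ge0 ?exprn_ge0 ?invr_ge0 ?(ltW y1')//.
  by rewrite natM_expr_le// y0.
by rewrite mulrC -ler_pdivrMr.
Qed.

(** Let r tend to 1, quantitatively through Bernoulli's inequality. *)
Lemma le_of_expr_le (S X : R) m : 0 <= S -> 0 <= X ->
  (forall r : R, 0 < r < 1 -> r ^+ m * S <= X) -> S <= X.
Proof.
move=> S0 X0 rX; rewrite leNgt; apply/negP => XS.
have bern (t : R) : 0 <= t <= 1 -> 1 - m%:R * t <= (1 - t) ^+ m.
  move=> /andP[t0 t1]; elim: (m) => [|k IHk]; first by rewrite expr0 mul0r subr0.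
  apply: (@le_trans _ _ ((1 - t) * (1 - k%:R * t))).
    have : 0 <= k%:R * t * t by rewrite !mulr_ge0.
    by rewrite -natr1; lra.
  by rewrite exprS ler_wpM2l//; lra.
have S0' : 0 < S by lra.
pose q := S * (m%:R + 1).
have q0 : 0 < q by rewrite mulr_gt0// ltr_wpDl.
pose t := (S - X) / 2 / q.
have t0 : 0 < t by rewrite !divr_gt0//; lra.
have Sq : S <= q by rewrite /q ler_peMr// lerDr.
have t1 : t < 1 by rewrite ltr_pdivrMr//; lra.
have tq : t * q = (S - X) / 2 by rewrite /t divfK// gt_eqF.
have := rX (1 - t); rewrite subr_gt0 t1 gtrBl t0 => /(_ isT).
have bt : 1 - m%:R * t <= (1 - t) ^+ m by apply: bern; rewrite !ltW.
have /= := ler_wpM2r S0 bt.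
move: tq; rewrite /q; have := mulr_gt0 t0 S0'; nra.
Qed.

End RealEstimates.

Section BoundedFunctions.
Variables (R : realType) (n : nat).
Local Notation C := R[i].
Local Notation multiindex := (multiindex n).
Implicit Types (z : 'rV[C]_n).

(** Dominated by the product of n geometric series, expanded over a box of
    exponents. *)
Lemma monomial_abs_bounded z : in_polydisc z -> abs_bounded (monomial z).
Proof.
move=> /polydisc_radius[r [r0 r1 zr]].
exists ((1 - r)^-1 ^+ n) => A; have [L AL] := fset_below A.
have F0 k : 0 <= normc (monomial z k) by exact: normc_ge0.
apply: le_trans (sum_fset_le F0 AL) _.
pose e (j : {ffun 'I_n -> 'I_L}) : multiindex := [ffun i => (j i : nat)].
apply: (@le_trans _ _ (\sum_j normc (monomial z (e j)))).
  have einj : injective e.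
    move=> j j' /ffunP jj; apply/ffunP => i; apply/val_inj.
    by have := jj i; rewrite !ffunE.
  rewrite (@perm_big _ _ _ _ _ [seq e j | j <- enum {ffun 'I_n -> 'I_L} &
      (mdeg (e j) < L)%N])/=.
    rewrite big_map big_filter big_enum_cond/= big_mkcond/=.
    by apply: ler_sum => j _; case: ifP.
  apply: uniq_perm; first exact: fset_uniq.
    by rewrite map_inj_uniq//; apply/filter_uniq/enum_uniq.
  move=> k; rewrite in_below; apply/idP/mapP => [kL|[j + ->]]; last first.
    by rewrite mem_filter => /andP[].
  have kE : k = e [ffun i => Ordinal (leq_ltn_trans (mdeg_ge k i) kL)].
    by apply/ffunP => i; rewrite !ffunE.
  by eexists; last exact: kE; rewrite mem_filter -kE kL mem_enum.
rewrite (eq_bigr (fun j : {ffun 'I_n -> 'I_L} => \prod_i normc (z 0 i) ^+ j i)).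
  rewrite -(bigA_distr_bigA (fun i (m : 'I_L) => normc (z 0 i) ^+ m)).
  rewrite -[X in _ ^+ X]card_ord -prodr_const; apply: ler_prod => i _.
  rewrite sumr_ge0 => [|m _]; last by rewrite exprn_ge0 ?normc_ge0.
  rewrite -[leRHS]mul1r ler_pdivlMr ?subr_gt0//=.
  apply: (@le_trans _ _ ((\sum_(m < L) r ^+ m) * (1 - r))).
    rewrite ler_wpM2r ?subr_ge0 ?(ltW r1)//; apply: ler_sum => m _.
    by rewrite lerXn2r ?nnegrE ?normc_ge0// ltW.
  rewrite -[_ * _]opprK -mulrN opprB mulrC -subrX1 opprB gerBl.
  by rewrite exprn_ge0// ltW.
move=> j _; rewrite /monomial normc_prod; apply: eq_bigr => i _.
by rewrite normcX ffunE.
Qed.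

Variables (f : polydisc R n -> C) (c : multiindex -> C) (M : R).
Hypothesis fc : slice_analytic f c.
Hypothesis fM : forall w, normc (f w) <= M.

Let M0 : 0 <= M.
Proof.
have [|o _] := @in_polydiscP R n 0; first by move=> i; rewrite mxE Normc.normc0.
exact: le_trans (normc_ge0 _) (fM o).
Qed.

Let extend_le z : normc (extend f z) <= M.
Proof.
rewrite /extend; case: insubP => [w _ _|_]; first exact: fM.
by rewrite [oapp _ _ _]/= Normc.normc0.
Qed.

Lemma slice_remainder z u (s : R) L : (forall i, normc (z 0 i) <= 1) ->
  0 < s < 1 -> normc u <= s ->
  normc (slice f z u - \sum_(m < L) hpart c m z * u ^+ m) <=
    L.+1%:R * M * (normc u / s) ^+ L.
Proof.
move=> z1 /andP[s0 s1] us; have [f2 fT] := fc.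
apply: (@taylor_remainder _ (slice f z) (fun m => hpart c m z)) => //.
- move=> w ws _; apply: f2 => i; rewrite mxE Normc.normcM.
  apply: le_lt_trans (ler_piMr _ (z1 i)) (le_lt_trans ws s1).
  exact: normc_ge0.
- by move=> w _; exact: extend_le.
Qed.

(** Points with coordinates at most r are [r z'] with z' in the closed polydisc,
    so [slice_remainder] on the circle of radius [s = (1 + r) / 2] gives an error
    of at most [(L + 1) M (r / s)^L]. *)
Lemma power_series_uniform (r e : R) : 0 < r < 1 -> 0 < e ->
  exists L0, forall L, (L0 <= L)%N -> forall z, (forall i, normc (z 0 i) <= r) ->
    normc (\sum_(k <- below n L) c k * monomial z k - extend f z) <= e.
Proof.
move=> /andP[r0 r1] e0; pose s := (1 + r) / 2.
have s0 : 0 < s by rewrite /s; lra.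
have s1 : s < 1 by rewrite /s; lra.
have rs : r < s by rewrite /s; lra.
have [||L0 Le] := @expr_decay R (r / s) (e / (M + 1)).
- by rewrite divr_ge0 ?(ltW r0) ?(ltW s0)//= ltr_pdivrMr// mul1r.
- by rewrite divr_gt0// ltr_wpDl.
exists L0 => L /Le {}Le z zr; rewrite sum_hpart.
have r0' : r%:C != 0 by rewrite -(rmorph0 (real_complex R)) (inj_eq (@complexI R)) gt_eqF.
have zE : z = r%:C *: (r%:C^-1 *: z) by rewrite scalerA mulfV// scale1r.
have nr : normc r%:C = r by rewrite normc_real gtr0_norm.
rewrite normcB {1}zE.
have -> : \sum_(m < L) hpart c m z =
    \sum_(m < L) hpart c m (r%:C^-1 *: z) * r%:C ^+ m.
  by apply: eq_bigr => m _; rewrite -hpartZ -zE.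
apply: le_trans (slice_remainder _ _ (_ : 0 < s < 1) _) _.
- move=> i; rewrite mxE Normc.normcM Normc.normcV nr mulrC ler_pdivrMr// mul1r.
  exact: zr.
- by rewrite s0.
- by rewrite nr ltW.
rewrite nr mulrAC; apply: le_trans (ler_wpM2r M0 Le) _.
by rewrite mulrAC ler_pdivrMr ?ltr_wpDl// ler_wpM2l ?(ltW e0)// lerDl.
Qed.

(** For [r < 1] the partial sums of the series on the torus of radius r are
    bounded by [M + e]; by Parseval on a fine grid so is the square root of
    [sum |c k|^2 r^(2 deg k)].  Then r tends to 1. *)
Lemma coef_square_sum_le (A : {fset multiindex}) (e : R) : 0 < e ->
  \sum_(k <- A) normc (c k) ^+ 2 <= (M + e) ^+ 2.
Proof.
move=> e0; have [d Ad] := fset_below A.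
apply: (@le_of_expr_le _ _ _ (2 * d)).
- by apply: sumr_ge0 => k _; exact: sqr_ge0.
- exact: sqr_ge0.
move=> r r01; have /andP[r0 r1] := r01.
have [L0 Le] := power_series_uniform r01 e0.
pose L := maxn (maxn L0 d) 1.
have L0L : (L0 <= L)%N by rewrite /L !leq_max leqnn.
have dL : (d <= L)%N by rewrite /L !leq_max leqnn orbT.
have Lpos : (0 < L)%N by rewrite /L leq_max orbT.
have [x px] := @exists_primitive_root R L Lpos.
pose b k := c k * r%:C ^+ mdeg k.
have nr : normc r%:C = r by rewrite normc_real gtr0_norm.
apply: (@le_trans _ _ (\sum_(k <- below n L) normc (b k) ^+ 2)).
  apply: (@le_trans _ _ (\sum_(k <- A) normc (b k) ^+ 2)); last first.
    apply: sum_fset_le => [k|]; first exact: sqr_ge0.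
    exact: fsubset_trans (below_subset n dL).
  rewrite mulr_sumr big_seq [leRHS]big_seq; apply: ler_sum => k kA.
  rewrite /b Normc.normcM exprMn mulrC ler_wpM2l ?sqr_ge0// normcX nr.
  rewrite -exprM mulnC ler_wiXn2l ?(ltW r0) ?(ltW r1)// leq_mul2r/=.
  by rewrite ltnW// -in_below (fsubsetP Ad).
have Ln : 0 < L%:R ^+ n :> R by rewrite exprn_gt0 ?ltr0n.
rewrite -(ler_pM2l Ln) -(grid_parseval px); last first.
  by move=> k; rewrite in_below => kL i; exact: leq_ltn_trans (mdeg_ge k i) kL.
apply: (@le_trans _ _ (\sum_(j : {ffun 'I_n -> 'I_L}) (M + e) ^+ 2)); last first.
  by rewrite sumr_const card_ffun !card_ord -natrX mulr_natl.
apply: ler_sum => j _.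
rewrite lerXn2r ?nnegrE ?normc_ge0 ?addr_ge0 ?(ltW e0)//.
have := Le _ L0L (r%:C *: grid_point x j).
under eq_bigr do rewrite monomialZ mulrA.
have gr i : normc ((r%:C *: grid_point x j) 0 i) <= r.
  by rewrite mxE Normc.normcM nr (normc_grid_point px) mulr1.
move=> /(_ gr); rewrite -/b; set S := \sum_(k <- _) _ => Se.
have -> : S = (S - extend f (r%:C *: grid_point x j)) +
    extend f (r%:C *: grid_point x j) by rewrite subrK.
by rewrite addrC; apply: le_trans (le_normcD _ _) _; rewrite lerD.
Qed.

(** The coefficients are bounded, so the series converges absolutely in the
    polydisc, and its sum is the limit along the degree. *)
Theorem bounded_hardy_expansion : hardy_expansion f c.
Proof.
split.
  apply/square_summableP; exists ((M + 1) ^+ 2) => A.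
  exact: coef_square_sum_le.
move=> z; have zD := polydisc_in z; apply: has_sum_of_below.
  have [K KA] := monomial_abs_bounded zD; exists ((M + 1) * K) => A.
  apply: (@le_trans _ _ (\sum_(k <- A) (M + 1) * normc (monomial z k))); last first.
    by rewrite -mulr_sumr ler_wpM2l//; have := M0; lra.
  apply: ler_sum => k _; rewrite Normc.normcM ler_wpM2r ?normc_ge0//.
  have := @coef_square_sum_le [fset k]%fset 1 ltr01; rewrite big_seq_fset1.
  by rewrite ler_pXn2r// ?nnegrE ?normc_ge0//; have := M0; lra.
move=> e e0; have [r [r0 r1 zr]] := polydisc_radius zD.
have [||L0 Le] := @power_series_uniform r (e / 2).
- by rewrite r0.
- lra.
exists L0 => L /Le /(_ _ zr); rewrite extend_val; lra.
Qed.

End BoundedFunctions.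

(** * The inner product of the Hardy space *)

Section HardyHilbert.
Variables (R : realType) (n : nat).
Local Notation C := R[i].
Local Notation multiindex := (multiindex n).
Local Notation H2 := (H2 R n).
Implicit Types (f g h : H2) (a : C).

(** The difference of two expansions expands the zero function, which is bounded
    by 0; [coef_square_sum_le] then bounds its coefficients by every [r > 0]. *)
Lemma expansion_unique (f : polydisc R n -> C) (c d : multiindex -> C) :
  hardy_expansion f c -> hardy_expansion f d -> c = d.
Proof.
move=> [c2 fc] [d2 fd]; pose e k := -1 * d k + c k.
have ez (z : polydisc R n) : has_sum (fun k => e k * monomial (polydisc_val z) k) 0.
  have := has_sumZD (a := -1) (fd z) (fc z); rewrite mulN1r addNr.
  by apply: eq_has_sum => k; rewrite /e; ring.
have slice0 (z : 'rV[C]_n) : slice (fun _ : polydisc R n => 0) z = fun=> 0.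
  by apply/funext => u; rewrite /slice /extend; case: insubP.
have e0 : slice_analytic (fun _ : polydisc R n => 0) e.
  split=> z; rewrite (slice0 z).
    by move=> u _; exists 0%:P; exact: taylor_at_cst.
  have [|o oE] := @in_polydiscP R n 0; first by move=> i; rewrite mxE Normc.normc0.
  move=> L; rewrite -(slice0 z); apply: (@local_series_slice _ _ _ o 1) => //.
    by move=> w _; rewrite oE subr0; exact: ez.
  by rewrite oE scale0r.
apply/funext => k; apply/esym/subr0_eq/Normc.eq0_normc/le_anti.
rewrite normc_ge0 andbT; apply/ler_addgt0Pr => r r0; rewrite add0r.
have := @coef_square_sum_le R n (fun=> 0) e 0 e0 _ [fset k]%fset r r0.
rewrite big_seq_fset1 add0r ler_pXn2r ?nnegrE ?normc_ge0 ?(ltW r0)//.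
rewrite /e mulN1r addrC normcB; apply => w.
by rewrite Normc.normc0.
Qed.

Lemma taylorP f : hardy_expansion f (taylor f).
Proof.
case: f => f fH; have /set_mem[c fc] := fH.
exact: (@xgetPex _ (fun=> 0) _ (ex_intro _ c fc)).
Qed.

Lemma H2_valZD a f g (z : polydisc R n) : (a *: f + g) z = a * f z + g z.
Proof. by []. Qed.

Lemma taylorZD a f g :
  taylor (a *: f + g) = fun k => a * taylor f k + taylor g k.
Proof.
apply: (expansion_unique (taylorP _)).
have [f2 fE] := taylorP f; have [g2 gE] := taylorP g; split.
  exact: square_summableZD.
move=> z; rewrite H2_valZD; have := has_sumZD (a := a) (fE z) (gE z).
by apply: eq_has_sum => k; rewrite mulrDl mulrA.
Qed.

Lemma H2_eq0 f : (forall k, taylor f k = 0) -> f = 0.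
Proof.
move=> f0; apply/val_inj/funext => z /=.
have [_ /(_ z) fz] := taylorP f.
apply: has_sum_unique fz _; apply/has_sumP => e e0; exists fset0 => B _.
by rewrite big1 ?subrr ?Normc.normc0// => k _; rewrite f0 mul0r.
Qed.

Lemma dotP f g : has_sum (fun k => taylor f k * (taylor g k)^*) (dot f g).
Proof.
have [|l fg] := @abs_bounded_has_sum R n (fun k => taylor f k * (taylor g k)^*).
  have [f2 _] := taylorP f; have [g2 _] := taylorP g.
  apply: square_summable_prod f2 _.
  move/square_summableP: g2 => [K gK]; apply/square_summableP; exists K => A.
  apply: le_trans (gK A); apply: ler_sum => k _.
  by case: (taylor g k) => x y /=; rewrite sqrrN.
suff -> : dot f g = l by [].
by apply: cvg_lim fg; exact: norm_hausdorff.
Qed.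

Lemma dotE f g l : has_sum (fun k => taylor f k * (taylor g k)^*) l ->
  dot f g = l.
Proof. by move=> fl; exact: has_sum_unique (@dotP f g) fl. Qed.

Lemma dotZDl a f g h : dot (a *: f + g) h = a * dot f h + dot g h.
Proof.
apply: dotE; have := has_sumZD (a := a) (@dotP f h) (@dotP g h).
by apply: eq_has_sum => k; rewrite taylorZD mulrDl mulrA.
Qed.

Lemma dotC f g : dot g f = (dot f g)^*.
Proof.
apply: dotE; have := has_sum_conj (@dotP f g); apply: eq_has_sum => k.
by rewrite rmorphM/= conjCK mulrC.
Qed.

Lemma dotBl f g h : dot (f - g) h = dot f h - dot g h.
Proof. by rewrite -[f - g]addrC -scaleN1r dotZDl mulN1r addrC. Qed.

Lemma dotDl f g h : dot (f + g) h = dot f h + dot g h.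
Proof. by rewrite -[f in LHS]scale1r dotZDl mul1r. Qed.

Lemma dotDr f g h : dot h (f + g) = dot h f + dot h g.
Proof. by rewrite (dotC (f + g)) dotDl rmorphD (dotC f h) (dotC g h). Qed.

Lemma dot_pos f : exists2 l : R, 0 <= l &
  dot f f = l%:C /\ forall k, normc (taylor f k) ^+ 2 <= l.
Proof.
have [||l l0 [fl fk]] := @has_sum_nonneg R n (fun k => normc (taylor f k) ^+ 2).
- by move=> k; exact: sqr_ge0.
- have [/square_summableP[K fK] _] := taylorP f; exists K => A.
  apply: le_trans (fK A); apply: ler_sum => k _.
  by rewrite normc_real ger0_norm ?sqr_ge0.
exists l => //; split=> [|k].
  by apply: dotE; apply: eq_has_sum fl => k; exact: sqr_normcC.
by have := fk [fset k]%fset; rewrite big_seq_fset1.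
Qed.

(** The value [dot f f] dominates each [|taylor f k|^2]. *)
Lemma dot_eq0 f : dot f f = 0 -> f = 0.
Proof.
have [l l0 [-> fl]] := dot_pos f => /(@complexI _ l 0) l00.
apply: H2_eq0 => k; apply/Normc.eq0_normc/eqP; rewrite -sqrf_eq0 eq_le sqr_ge0.
by rewrite -l00 fl.
Qed.

Lemma Re_dot_ge0 f : 0 <= complex.Re (dot f f).
Proof. by have [l l0 [-> _]] := dot_pos f. Qed.

Lemma hnorm_eq0 f : hnorm f = 0 -> f = 0.
Proof.
rewrite /hnorm; have [l l0 [fl _]] := dot_pos f; rewrite fl /= => /eqP.
rewrite sqrtr_eq0 => l0'; apply: dot_eq0; rewrite fl.
by have -> : l = 0 by apply/le_anti; rewrite l0 l0'.
Qed.

(** For orthogonal f and g, [|f + g|^2 = |f|^2 + |g|^2]. *)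
Lemma hnorm_pythagoras f g : dot f g = 0 -> hnorm f <= hnorm (f + g).
Proof.
move=> fg; rewrite /hnorm.
have gf : dot g f = 0 by rewrite (dotC f g) fg conjC0.
have -> : dot (f + g) (f + g) = dot f f + dot g g.
  by rewrite dotDl (dotDr f g f) (dotDr f g g) fg gf addr0 add0r.
apply: ler_wsqrtr.
have -> : complex.Re (dot f f + dot g g) = complex.Re (dot f f) + complex.Re (dot g g).
  by case: (dot f f) (dot g g) => ? ? [].
by rewrite lerDl Re_dot_ge0.
Qed.

End HardyHilbert.

(** * Projections and inner functions *)

Section Projections.
Variables (R : realType) (n : nat).
Local Notation C := R[i].
Local Notation H2 := (H2 R n).
Implicit Types (f g : H2) (P : H2 -> H2) (M : set H2).

Definition linear_subspace M :=
  forall (a : C) f g, M f -> M g -> M (a *: f + g).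

Lemma linear_subspaceB M f g : linear_subspace M -> M f -> M g -> M (f - g).
Proof. by move=> ML Mf Mg; rewrite addrC -scaleN1r; exact: ML. Qed.

Lemma mult_range_subspace (phi : polydisc R n -> C) :
  linear_subspace (mult_range phi).
Proof.
move=> a f g [f' ff] [g' gg]; exists (a *: f' + g') => z.
by rewrite !H2_valZD ff gg; ring.
Qed.

(** The vector [f - P f] lies in M and is orthogonal to M. *)
Lemma projection_id P M f : linear_subspace M -> orthogonal_projection P M ->
  M f -> P f = f.
Proof.
move=> ML PM Mf; have [MP fP] := PM f.
by apply/esym/subr0_eq/dot_eq0/fP; exact: linear_subspaceB.
Qed.

(** The distance from f to M is attained at [P f], so it vanishes only when f is
    in M: a subspace with an orthogonal projection is closed. *)
Lemma projection_closed P M f : linear_subspace M -> orthogonal_projection P M ->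
  (forall e : R, 0 < e -> exists2 g, M g & hnorm (f - g) < e) -> M f.
Proof.
move=> ML PM fM; have [MP fP] := PM f.
suff /hnorm_eq0/subr0_eq -> : hnorm (f - P f) = 0 by [].
apply/le_anti; rewrite sqrtr_ge0 andbT; apply/ler_addgt0Pr => e e0; rewrite add0r.
have [g Mg fg] := fM e e0; apply: le_trans (ltW fg).
have -> : f - g = (f - P f) + (P f - g) by rewrite addrA subrK.
by apply/hnorm_pythagoras/fP; exact: linear_subspaceB.
Qed.

Lemma projection_dot P M f g : orthogonal_projection P M -> M g ->
  dot (P f) g = dot f g.
Proof.
by move=> PM Mg; have [_ /(_ g Mg)] := PM f; rewrite dotBl => /subr0_eq ->.
Qed.

Lemma meet_closed P Q M N : linear_subspace M -> linear_subspace N ->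
  orthogonal_projection P M -> orthogonal_projection Q N ->
  closed_subspace (M `&` N).
Proof.
move=> ML NL PM QN; split.
- have [MP _] := PM 0; have [NQ _] := QN 0.
  by split; [rewrite -(subrr (P 0))|rewrite -(subrr (Q 0))];
     exact: linear_subspaceB.
- by move=> a f g [Mf Nf] [Mg Ng]; split; [exact: ML|exact: NL].
move=> f fMN; split.
  by apply: (projection_closed ML PM) => e /fMN[g [Mg _] fg]; exists g.
by apply: (projection_closed NL QN) => e /fMN[g [_ Ng] fg]; exists g.
Qed.

(** For f orthogonal to the intersection and g in it, self-adjointness of the
    projections gives [dot (P (Q f)) g = dot (Q f) g = dot f g = 0]. *)
Lemma product_projections_meet P Q M N (T : H2 -> H2) :
  linear_subspace M -> linear_subspace N ->
  orthogonal_projection P M -> orthogonal_projection Q N ->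
  (forall f, T f = P (Q f)) ->
  reducing T (M `&` N) /\ unitary_on T (M `&` N).
Proof.
move=> ML NL PM QN TE.
have Tid f : (M `&` N) f -> T f = f.
  by move=> [Mf Nf]; rewrite TE (projection_id NL QN)// (projection_id ML PM).
split; split.
- by move=> _ [f Mf <-]; rewrite Tid.
- move=> _ [f fMN <-] g MNg; have [Mg Ng] := MNg.
  by rewrite TE (projection_dot _ PM)// (projection_dot _ QN)// fMN.
- apply/seteqP; split=> [_ [f Mf <-]|f Mf]; first by rewrite Tid.
  by exists f; rewrite ?Tid.
- by move=> f g Mf Mg; rewrite !Tid.
Qed.

End Projections.

Section InnerFunctions.
Variables (R : realType) (n : nat).
Local Notation C := R[i].
Implicit Types (phi psi : polydisc R n -> C).

Lemma bounded_normc phi : (exists M : R, forall z, `|phi z| <= M%:C) ->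
  exists M : R, forall z, normc (phi z) <= M.
Proof. by move=> [M fM]; exists M => z; rewrite -lecR -abs_normc. Qed.

Lemma HinftyM_hardy phi psi : Hinfty phi -> Hinfty psi ->
  exists f : H2 R n, forall z, f z = phi z * psi z.
Proof.
move=> [/analytic_slice[c phic] /bounded_normc[K phiK]].
move=> [/analytic_slice[d psid] /bounded_normc[L psiL]].
have fH : ((fun z => phi z * psi z) : polydisc R n -> C^o) \in hardy (R := R) (n := n).
  apply/mem_set; exists (convolution c d).
  apply: (@bounded_hardy_expansion _ _ _ _ (K * L)).
    exact: slice_analyticM.
  by move=> z; rewrite Normc.normcM ler_pM ?normc_ge0.
by exists (MkH2 fH).
Qed.

Lemma Hinfty_hardy phi : Hinfty phi -> exists f : H2 R n, forall z, f z = phi z.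
Proof.
move=> [/analytic_slice[c phic] /bounded_normc[K phiK]].
have fH : (phi : polydisc R n -> C^o) \in hardy (R := R) (n := n).
  by apply/mem_set; exists c; exact: bounded_hardy_expansion phiK.
by exists (MkH2 fH).
Qed.

(** Two almost sure events of a probability space have a common point t; along
    the radius towards t both functions are eventually nonzero. *)
Lemma inner_common_neq0 phi psi : inner_function phi -> inner_function psi ->
  exists z, phi z * psi z != 0.
Proof.
move=> [_ phi1] [_ psi1].
have PF : ProperFilter (almost_everywhere (uniform_cube R n)).
  apply: ae_properfilter_algebraOfSetsType.
  by have := probability_setT (uniform_cube R n) => /= ->.
have [t [[l [l1 phil]] [m [m1 psim]]]] := filter_ex (filterI phi1 psi1).
have l0 : l != 0 by rewrite -normr_eq0 l1 oner_eq0.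
have m0 : m != 0 by rewrite -normr_eq0 m1 oner_eq0.
have [r [/= rphi rpsi]] := filter_ex (filterI (cvgr_neq0 _ phil l0) (cvgr_neq0 _ psim m0)).
move: rphi rpsi; rewrite /extend; case: insubP => [w _ _|_] /=; last by rewrite eqxx.
by move=> w1 w2; exists w; rewrite mulf_neq0.
Qed.

End InnerFunctions.

Theorem corollary3p3 (R : realType) (n : nat) (hn : (1 <= n)%N)
    (T : {linear H2 R n -> H2 R n}) (Tbounded : bounded_op T)
    (Tcontraction : contraction_op T) (Tcnu : completely_non_unitary T) :
  ~ exists P Q : {linear H2 R n -> H2 R n},
      [/\ inner_projection P, inner_projection Q &
          forall f : H2 R n, T f = P (Q f)].
Proof.
move=> [P [Q [[phi phi1 Pphi] [psi psi1 Qpsi] TE]]]; apply: Tcnu.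
have Ml := @mult_range_subspace _ _ phi; have Nl := @mult_range_subspace _ _ psi.
exists (mult_range phi `&` mult_range psi).
have [red uni] := product_projections_meet Ml Nl Pphi Qpsi TE.
split=> //; first exact: meet_closed Pphi Qpsi.
have [f fE] := HinftyM_hardy phi1.1 psi1.1.
have [a aE] := Hinfty_hardy phi1.1; have [b bE] := Hinfty_hardy psi1.1.
move=> /seteqP[/(_ f) f0 _]; have [z] := inner_common_neq0 phi1 psi1.
rewrite -fE f0 ?eqxx//; split.
  by exists b => w; rewrite fE bE.
by exists a => w; rewrite fE aE mulrC.
Qed.
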